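(* Suppose that $E = B_1 \times B_2 \times B_3$, where $B_j \subset [0,1]$ satisfy $\dim_{\mathcal H}(B_j) > \frac{2}{3}$ for $j = 1,2,3$. Then $\mathcal{L}^1(\mathcal{V}(E)) > 0$.
   Context: $\dim_{\mathcal H}$ denotes Hausdorff dimension and $\mathcal{L}^1$ denotes one-dimensional Lebesgue measure on $\mathbb{R}$. For $E \subset [0,1]^3$, the volume set of $E$ is $\mathcal{V}(E) = \{\det(x^1,x^2,x^3) \in \mathbb{R} : x^1,x^2,x^3 \in E\}$, where $\det(x^1,x^2,x^3)$ is the determinant of the $3\times 3$ matrix whose $j$th column is $x^j$.
   Formalization: The sets B_j are additionally assumed to be Borel; for arbitrary subsets of [0,1] the claim can fail or L^1(V(E)) can be undefined (take B_j = K ∩ [0,1] for a suitable non-Borel proper subfield K of the reals). *)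

(* Defs.v *)
From HB Require Import structures.
From mathcomp Require Import all_boot all_order all_algebra.
From mathcomp Require Import all_classical all_reals all_analysis.

Set Implicit Arguments.
Unset Strict Implicit.
Unset Printing Implicit Defensive.

Import Order.TTheory GRing.Theory Num.Theory.
Import numFieldNormedType.Exports.

Local Open Scope classical_set_scope.
Local Open Scope ring_scope.

Section hausdorff.
Context {R : realType} {V : pseudoMetricNormedZmodType R}.
Implicit Types (A U : set V) (s delta : R).
Local Open Scope ereal_scope.

(* diam set0 = -oo, since it is the supremum of an empty set in \bar R. *)
Definition diam A : \bar R := ereal_sup [set `|x - y|%:E | x in A & y in A].

(* The empty set weighs 0 also for s = 0, whereas a nonempty set of
   diameter 0 then weighs 0 `^ 0 = 1; hence the 0-dimensional measure counts
   points, and finite covers may be padded with empty sets. *)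
Definition hausdorff_weight s U : \bar R :=
  if U == set0 then 0 else (diam U) `^ s.

Definition hausdorff_content s delta A : \bar R :=
  ereal_inf [set \sum_(0 <= i <oo) hausdorff_weight s (U i) |
    U in [set U : (set V)^nat |
      A `<=` \bigcup_i U i /\ forall i, diam (U i) <= delta%:E]].

Definition hausdorff_measure s A : \bar R :=
  ereal_sup [set hausdorff_content s delta A |
    delta in [set delta : R | (0 < delta)%R]].

Definition hausdorff_dim A : \bar R :=
  ereal_inf [set s%:E |
    s in [set s : R | (0 <= s)%R /\ hausdorff_measure s A = 0]].

End hausdorff.

Definition product_set {R : realType} (B : 'I_3 -> set R) : set 'cV[R]_3 :=
  [set x | forall j, B j (x j ord0)].

Definition volume_set {R : realType} (E : set 'cV[R]_3) : set R :=
  [set \det (\matrix_(i, j) x j i ord0) |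
    x in [set x : 'I_3 -> 'cV[R]_3 | forall j, E (x j)]].

(* Main.v *)
Require Import Defs.
From HB Require Import structures.
From mathcomp Require Import all_boot all_order all_algebra.
From mathcomp Require Import all_classical all_reals all_analysis.
From mathcomp Require Import zify ring lra.
From mathcomp Require finmap.

Import Order.TTheory GRing.Theory Num.Theory.
Import numFieldNormedType.Exports.

Local Open Scope classical_set_scope.
Local Open Scope ring_scope.

(** Fix be in B_1 and ga > 0 in B_2 (rows numbered from 0).  The determinant of
    the columns (a1, b1, ga), (a2, b2, ga), (a3, be, c) is the linear form a . u
    in a = (a1, a2, a3), where
      u = (b2 c - be ga, be ga - b1 c, ga (b1 - b2)).
    With a in B_0^3, b1, b2 in B_1 and c in B_2, both a and (b1, b2, c) range
    over products of three sets of dimension s > 2/3, and (b1, b2, c) is a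
    Lipschitz function of u as long as b1 - b2 and c stay away from 0
    ([inverse_lipschitz]).

    Let mu be a Frostman measure of exponent s on B_0, and put the product of
    Frostman measures on (b1, b2, c).  On average over u, the image of mu x mu x mu
    under a |-> a . u has a square integrable density.  Indeed, by Plancherel, the
    squared norm of the density is the sum over frequencies m of the product over
    i of |mu^(m u_i)|^2.  For m about 2^k, this product is essentially constant at
    unit scale; the vector m u falls in a given unit cube with probability
    O(2^(-3 s k)), because u determines (b1, b2, c); and the sum of |mu^|^2 over the
    unit cells of [-2^k, 2^k] is O(2^((1 - s) k)), because mu is Frostman.  The
    frequencies about 2^k thus contribute at most 2^k 2^(-3 s k) 2^(3 (1 - s) k),
    which is summable over k exactly when s > 2/3.  By Cauchy-Schwarz, a measure
    with square integrable density cannot live on a set of measure zero.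

    All of this is carried out at a finite scale 2^-n, with weights on the points
    of the grid 2^-n Z instead of measures, and with finite exponential sums
    instead of Fourier transforms.  Below, rho stands for 2^-s, and the condition
    s > 2/3 reads 16 rho^6 < 1.  The local constancy is [expsum2_local], the
    Frostman bound on the exponential sums is [frostman_weight_energy], and the
    two are combined in [block_bound] and [discrete_main].  The outcome,
    [cells_count_lower], is that the values a . u meet at least e N of the
    intervals of length 1/N, with e independent of N.

    To turn this into a statement about Lebesgue measure one needs compact sets:
    a compact set of measure zero is covered by an open set of small measure that
    contains all the cells meeting it, once N is large ([image_measure_gt0]).  So
    each B_j has to be replaced by a compact subset that still carries Frostman
    weights at all scales.  This uses that B_j is a Borel set: Borel sets are
    obtained by the Suslin operation from closed sets ([measurable_suslin]), the
    dyadic net content is continuous along increasing sequences of arbitrary sets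
    ([net_content_bigcup]), and hence a Borel set of positive content contains a
    compact set of positive content ([capacitability]).  Positive content yields
    Frostman weights by a max-flow min-cut argument on the dyadic tree
    ([discrete_frostman]). *)

(** * Dyadic net content and its continuity along increasing sequences *)

Section net_content.
Context {R : realType}.
Variable rho : R.
Implicit Types (x : R) (A : set R) (U V W : set (nat * nat)).

Definition dyadic_idx (n : nat) x : nat := Num.truncn (x * 2 ^+ n).

Lemma dyadic_idx_itv n x : 0 <= x ->
  (dyadic_idx n x)%:R <= x * 2 ^+ n < (dyadic_idx n x).+1%:R.
Proof. by move=> x0; apply: truncn_itv; rewrite mulr_ge0 ?exprn_ge0. Qed.

Lemma dyadic_idx_eq n x k : k%:R <= x * 2 ^+ n < k.+1%:R -> dyadic_idx n x = k.
Proof. by move=> h; apply: truncn_def. Qed.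

Lemma dyadic_idx_div m n x : 0 <= x -> (m <= n)%N -> dyadic_idx m x = (dyadic_idx n x %/ 2 ^ (n - m))%N.
Proof.
move=> x0 mn; apply: dyadic_idx_eq.
have /andP[l u] := @dyadic_idx_itv n x x0.
set t := dyadic_idx n x in l u *; set d := (2 ^ (n - m))%N.
have d0 : (0 < d)%N by rewrite expn_gt0.
have dR : 0 < d%:R :> R by rewrite ltr0n.
have e : x * 2 ^+ n = x * 2 ^+ m * d%:R.
  by rewrite /d natrX -mulrA -exprD subnKC.
rewrite e in l u.
apply/andP; split.
  rewrite -(ler_pM2r dR) (le_trans _ l)// -natrM ler_nat; exact: leq_divM.
rewrite -(ltr_pM2r dR) (lt_le_trans u)// -natrM ler_nat; exact: ltn_ceil.
Qed.

Lemma dyadic_idx_lt n x : 0 <= x < 1 -> (dyadic_idx n x < 2 ^ n)%N.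
Proof.
move=> /andP[x0 x1]; have /andP[l _] := @dyadic_idx_itv n x x0.
rewrite -(ltr_nat R) (le_lt_trans l)// natrX.
by rewrite -ltr_pdivlMr ?exprn_gt0// divff ?lt0r_neq0 ?exprn_gt0.
Qed.

(** A node (n, k) stands for the dyadic interval [k / 2^n, (k + 1) / 2^n); it
    has weight rho^n.  With rho = 2^-s this is the power s of its length. *)
Definition covers U A := forall x, A x -> exists n, U (n, dyadic_idx n x).

(** The weight of a possibly infinite family is bounded through its finite
    parts, so that no extended real number is involved. *)
Definition cost_le U (c : R) := forall L : seq (nat * nat), uniq L ->
  (forall q, q \in L -> U q) -> \sum_(q <- L) rho ^+ q.1 <= c.

Definition net_content A : R := inf [set c | exists U, covers U A /\ cost_le U c].

Let unit_itv : set R := [set x | 0 <= x < 1].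

Lemma cost_ge0 U c : cost_le U c -> 0 <= c.
Proof. by move=> /(_ [::] isT); rewrite big_nil; apply. Qed.

Lemma net_content_has_inf A : A `<=` unit_itv ->
  has_inf [set c | exists U, covers U A /\ cost_le U c].
Proof.
move=> A01; split; last by exists 0 => c [U [_ /cost_ge0]].
exists 1, [set (0%N, 0%N)]; split=> [x /A01/(dyadic_idx_lt 0)|L uL hL].
  by move=> i0; exists 0%N => /=; case: (dyadic_idx 0 x) i0.
case: L uL hL => [|q [|r L]] uL hL; rewrite ?big_nil ?ler01//.
  by rewrite big_seq1 (hL q _) ?mem_head// expr0.
have E := hL q (mem_head _ _); have E' := hL r _.
by move: uL; rewrite /= E E' ?inE ?eqxx ?orbT.
Qed.

Lemma net_content_le A U c : covers U A -> cost_le U c -> net_content A <= c.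
Proof.
move=> cU cc; apply: ge_inf; last by exists U.
by exists 0 => d [V [_ /cost_ge0]].
Qed.

Lemma net_content_approx A e : A `<=` unit_itv -> 0 < e ->
  exists U, covers U A /\ cost_le U (net_content A + e).
Proof.
move=> A01 e0; have [c [U [cU cc]] lt] := inf_adherent e0 (net_content_has_inf _ A01).
by exists U; split=> // L uL hL; rewrite (le_trans (cc L uL hL))// ltW.
Qed.

Lemma cost_subset U V c : U `<=` V -> cost_le V c -> cost_le U c.
Proof. by move=> UV cV L uL hL; apply: cV => // q /hL/UV. Qed.

(** Up to any e > 0, the content is already reached by a finite part of any
    covering family: otherwise the family would be too cheap a cover. *)
Lemma cost_lower A U e : covers U A -> 0 < e ->
  exists L, [/\ uniq L, (forall q, q \in L -> U q) &
    net_content A - e <= \sum_(q <- L) rho ^+ q.1].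
Proof.
move=> cU e0; apply: contrapT => H.
have : net_content A <= net_content A - e.
  apply: (net_content_le _ U) => // L uL hL; rewrite leNgt; apply/negP => lt.
  by apply: H; exists L; split=> //; exact: ltW.
by rewrite lerDl oppr_ge0 leNgt e0.
Qed.

Definition ancestor (r q : nat * nat) :=
  (r.1 <= q.1)%N /\ r.2 = (q.2 %/ 2 ^ (q.1 - r.1))%N.

Lemma ancestor_idx x m n : 0 <= x -> (m <= n)%N -> ancestor (m, dyadic_idx m x) (n, dyadic_idx n x).
Proof. by move=> x0 mn; split=> //=; apply: dyadic_idx_div. Qed.

Lemma ancestor_trans r q p : ancestor r q -> ancestor q p -> ancestor r p.
Proof.
move=> [h1 e1] [h2 e2]; split; first exact: leq_trans h2.
rewrite e1 e2 -divnMA -expnD; congr (_ %/ 2 ^ _)%N; lia.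
Qed.

Definition maximal_nodes W : set (nat * nat) :=
  [set q | W q /\ forall r, W r -> ancestor r q -> r = q].

Lemma ancestor_refl q : ancestor q q.
Proof. by split=> //; rewrite subnn expn0 divn1. Qed.

Lemma ancestor_anti r q : ancestor r q -> (q.1 <= r.1)%N -> r = q.
Proof.
case: r => r1 r2; case: q => q1 q2 [/= h1 ->] h2.
have -> : r1 = q1 by apply/eqP; rewrite eqn_leq h1 h2.
by rewrite subnn expn0 divn1.
Qed.

(** Generations are natural numbers, so an ascending chain of nodes is
    finite. *)
Lemma maximal_nodes_ancestor W q : W q -> exists2 r, maximal_nodes W r & ancestor r q.
Proof.
move=> Wq; have [n] := ubnP q.1; elim: n q Wq => // n IH q Wq lt.
have [tq|ntq] := pselect (maximal_nodes W q); first by exists q => //; exact: ancestor_refl.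
have [r Wr [arq rq]] : exists2 r, W r & ancestor r q /\ r <> q.
  apply: contrapT => H; apply: ntq; split=> // r Wr arq.
  by apply: contrapT => ne; apply: H; exists r.
have rlt : (r.1 < q.1)%N by rewrite ltnNge; apply/negP => /(ancestor_anti _ _ arq).
have [|s ts asr] := IH r Wr; first exact: (leq_trans rlt).
by exists s => //; apply: ancestor_trans arq.
Qed.

Lemma maximal_nodes_covers W A : A `<=` unit_itv -> covers W A -> covers (maximal_nodes W) A.
Proof.
move=> A01 cW x Ax; have [n Wn] := cW x Ax.
have /andP[x0 _] := A01 _ Ax.
have [[m k] tr [/= mn e]] := maximal_nodes_ancestor _ _ Wn.
by exists m; rewrite (dyadic_idx_div m n)// -e.
Qed.

(** Two dyadic intervals with a common point are nested.  So the maximal nodes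
    of W that lie below nodes of U, together with the nodes of U that lie strictly
    below maximal nodes of W, still cover A, and weigh at least its content.  What
    is left of the maximal nodes of W and of U after their removal contains the
    maximal nodes of W `|` U. *)
Lemma maximal_nodes_step W U A A' c c' : A `<=` A' -> A' `<=` unit_itv ->
  covers W A -> covers U A' -> cost_le (maximal_nodes W) c -> cost_le U c' ->
  cost_le (maximal_nodes (W `|` U)) (c + c' - net_content A).
Proof.
move=> AA' A'01 cW cU cV cc L uL hL; apply/ler_addgt0Pr => e e0.
have A01 : A `<=` unit_itv by apply: subset_trans A'01.
(* Equal nodes are counted in V1 only, since U1 asks for strict ancestors. *)
pose V1 := [set q | maximal_nodes W q /\ exists2 r, U r & ancestor r q].
pose U1 := [set r | U r /\ exists2 q, maximal_nodes W q & ancestor q r /\ q <> r].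
have cV1 : covers (V1 `|` U1) A.
  move=> x Ax; have /andP[x0 _] := A01 _ Ax.
  have [a Pa] := maximal_nodes_covers _ _ A01 cW x Ax.
  have [b Rb] := cU x (AA' _ Ax).
  have [ba|ab] := leqP b a.
    by exists a; left; split=> //; exists (b, dyadic_idx b x) => //; exact: ancestor_idx.
  exists b; right; split=> //; exists (a, dyadic_idx a x) => //.
  by split; [exact/ancestor_idx/ltnW|move=> [E]; rewrite E ltnn in ab].
have [L' [uL' hL' lb]] := cost_lower _ _ _ cV1 e0.
have split_sum (M : seq (nat * nat)) (P : pred (nat * nat)) :
  \sum_(q <- M) rho ^+ q.1 = \sum_(q <- [seq q <- M | P q]) rho ^+ q.1 +
     \sum_(q <- [seq q <- M | ~~ P q]) rho ^+ q.1.
  by rewrite !big_filter (bigID P).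
pose P q := `[< maximal_nodes W q /\ ~ V1 q >].
pose P' q := `[< V1 q >].
have h1 : \sum_(q <- [seq q <- L | P q] ++ [seq q <- L' | P' q]) rho ^+ q.1 <= c.
  apply: cV.
    rewrite cat_uniq !filter_uniq// andbT /=; apply/hasPn => q.
    rewrite !mem_filter => /andP[/asboolP Vq _]; apply/negP => /andP[/asboolP[_ nV] _].
    exact: nV.
  move=> q; rewrite mem_cat !mem_filter => /orP[/andP[/asboolP[]]|/andP[/asboolP[]]]//.
have h2 : \sum_(q <- [seq q <- L | ~~ P q] ++ [seq q <- L' | ~~ P' q]) rho ^+ q.1 <= c'.
  have key q : q \in L -> ~~ P q -> U q /\ ~ U1 q.
    move=> /hL[WUq mx] /asboolP nP.
    have nU1 : ~ U1 q.
      by move=> [_ [r [Wr _] [ar ne]]]; apply: ne; apply: mx => //; left.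
    split=> //; case: WUq => // Wq.
    have tq : maximal_nodes W q by split=> // r Wr; apply: mx; left.
    have V1q : V1 q by apply: contrapT => n; apply: nP.
    by case: V1q => _ [r Ur arq]; rewrite -(mx r) //; right.
  have key' q : q \in L' -> ~~ P' q -> U1 q.
    by move=> /hL'[Vq|//] /asboolP.
  apply: cc.
    rewrite cat_uniq !filter_uniq// andbT /=; apply/hasPn => q.
    rewrite !mem_filter => /andP[n1 m1]; apply/negP => /andP[n2 m2].
    by have [_ ] := key _ m2 n2; apply; exact: key'.
  move=> q; rewrite mem_cat !mem_filter => /orP[/andP[n m]|/andP[n m]].
    by have [] := key _ m n.
  by have [] := key' _ m n.
rewrite !big_cat/= in h1 h2.
have := split_sum L P; have := split_sum L' P'; lra.
Qed.

(** Choose covers U n of A n that are optimal up to e / 2^(n+1).  By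
    [maximal_nodes_step], the maximal nodes of U 0, ..., U n weigh at most the
    content of A n plus e, by induction on n.  A finite part of the maximal nodes
    of the whole union is among the maximal nodes of some finite stage. *)
Lemma net_content_bigcup (A : (set R)^nat) c :
  (forall n, A n `<=` A n.+1) -> (forall n, A n `<=` unit_itv) ->
  (forall n, net_content (A n) <= c) -> net_content (\bigcup_n A n) <= c.
Proof.
move=> incA A01 cA; apply/ler_addgt0Pr => e e0.
have eps n : 0 < e / 2 ^+ n.+1 by rewrite divr_gt0 ?exprn_gt0.
have /(_ _)/cid-/all_sig [U HU] n := net_content_approx _ _ (A01 n) (eps n).
pose W n := \bigcup_(k in [set k | (k < n.+1)%N]) U k.
have WS n : W n.+1 = W n `|` U n.+1.
  apply/seteqP; split=> [q [k /=]|q [[k /= kn]|]].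
  - rewrite ltnS leq_eqVlt => /orP[/eqP->|kn] Uk; [by right|by left; exists k].
  - by exists k => //=; apply: ltnW; rewrite ltnS.
  - by exists n.+1 => /=.
have cW n : covers (W n) (A n).
  by move=> x Ax; have [m Um] := (HU n).1 _ Ax; exists m, n => /=.
have costW n : cost_le (maximal_nodes (W n)) (net_content (A n) + e * (1 - 1 / 2 ^+ n.+1)).
  elim: n => [|n IH].
    have -> : W 0%N = U 0%N.
      apply/seteqP; split=> [q [k /=]|q Uq]; last by exists 0%N.
      by rewrite ltnS leqn0 => /eqP->.
    apply: (@cost_subset _ (U 0%N)); first by move=> q [].
    have := (HU 0%N).2; congr (cost_le _ (_ + _)); by rewrite expr1; field.
  have := maximal_nodes_step _ _ _ _ _ _ (incA n) (A01 n.+1) (cW n) (HU n.+1).1 IH (HU n.+1).2.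
  rewrite -WS; congr cost_le.
  have n0 : 2 ^+ n.+1 != 0 :> R by rewrite lt0r_neq0 ?exprn_gt0.
  by rewrite [2 ^+ n.+2]exprS; field.
pose Winf := \bigcup_n W n.
apply: (net_content_le _ (maximal_nodes Winf)).
  apply: maximal_nodes_covers; first by move=> x [n _ /A01].
  by move=> x [n _ Ax]; have [m Wm] := cW n x Ax; exists m, n.
move=> L uL hL.
have subW m n : (m <= n)%N -> W m `<=` W n.
  by move=> mn q [k /= km] Uk; exists k => //=; apply: (leq_trans km); rewrite ltnS.
have [n hn] : exists n, forall q, q \in L -> W n q.
  elim: L {uL} hL => [|q L IH] hL; first by exists 0%N.
  have [n hn] : exists n, forall q, q \in L -> W n q.
    by apply: IH => p pL; apply: hL; rewrite inE pL orbT.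
  have [|[m _ Wm] _] := hL q; first exact: mem_head.
  exists (maxn m n) => p; rewrite inE => /orP[/eqP->|/hn].
    by apply: subW Wm; exact: leq_maxl.
  by apply: subW; exact: leq_maxr.
apply: (le_trans (costW n L uL _)).
  move=> q qL; split; first exact: hn.
  by move=> r Wr; have [_ H] := hL _ qL; apply: H; exists n.
rewrite lerD//; rewrite ler_piMr ?(ltW e0)// gerBl divr_ge0 ?exprn_ge0//.
Qed.

End net_content.

(** * Borel sets are Suslin sets, and contain compact sets of positive content *)

(** Follow the prefixes that admit extensions of every length: one of the
    finitely many successors of such a prefix has the same property. *)
Lemma konig (T : seq nat -> Prop) (h : nat -> nat) :
  (forall s v, T (rcons s v) -> T s /\ (v <= h (size s))%N) ->
  (forall k, exists2 s, size s = k & T s) ->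
  exists sg : nat -> nat, forall k, T (mkseq sg k).
Proof.
move=> Th Tk.
have Tpre s t : T (s ++ t) -> T s.
  elim/last_ind: t => [|t v IH]; first by rewrite cats0.
  by rewrite -rcons_cat => /Th[/IH].
pose deep s := forall k, exists2 t, size t = k & T (s ++ t).
have step s : deep s -> exists v, deep (rcons s v).
  move=> ds; apply: contrapT => /forallNP H.
  have /choice[g Hg] : forall v, exists k, forall t, size t = k -> ~ T (rcons s v ++ t).
    move=> v; have /existsNP[k Hk] := H v; exists k => t st Tt; apply: Hk; by exists t.
  pose m := \max_(v < (h (size s)).+1) g v.
  have [[//|v t] [st] Tt] := ds m.+1.
  rewrite -cat_rcons in Tt.
  have vh : (v <= h (size s))%N by have [] := Th _ _ (Tpre _ _ Tt).
  have gm : (g v <= m)%N.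
    exact: (@leq_bigmax_cond _ predT (fun v : 'I_(h (size s)).+1 => g v) (Ordinal (vh : (v < (h (size s)).+1)%N))).
  apply: (Hg v (take (g v) t)); first by rewrite size_take st; case: ltngtP gm.
  by move: Tt; rewrite -{1}(cat_take_drop (g v) t) catA; exact: Tpre.
have /choice[f Hf] : forall s, exists v, deep s -> deep (rcons s v).
  move=> s; have [/step[v dv]|n] := pselect (deep s); first by exists v.
  by exists 0%N.
pose S := fix S k := if k is k'.+1 then rcons (S k') (f (S k')) else [::].
have dS k : deep (S k).
  elim: k => [k|k IH]; last exact: Hf.
  by have [s ss Ts] := Tk k; exists s.
exists (fun k => f (S k)) => k.
have -> : mkseq (fun k => f (S k)) k = S k.
  by elim: k => // k IH; rewrite mkseqS IH.
by have [t _ /Tpre] := dS k 0%N.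
Qed.

Lemma mkseq_cons {T} (f : nat -> T) k : mkseq f k.+1 = f 0%N :: mkseq (f \o S) k.
Proof. by rewrite /mkseq /= (iotaDl 1 0 k : iota 1 k = _) -map_comp. Qed.

Section suslin.
Context {R : realType}.
Implicit Types A B : set R.

(** The result of the Suslin operation on a scheme F of closed sets. *)
Definition suslin A := exists2 F : seq nat -> set R,
  (forall s, closed (F s)) &
  A = [set x | exists sg : nat -> nat, forall k, F (mkseq sg k) x].

Lemma suslin_closed A : closed A -> suslin A.
Proof.
move=> cA; exists (fun=> A) => //; apply/seteqP; split=> [x Ax|x [_ /(_ 0%N)]//].
by exists (fun=> 0%N).
Qed.

(** The first entry of a branch selects a set of the family. *)
Lemma suslin_bigcup (A : (set R)^nat) :
  (forall n, suslin (A n)) -> suslin (\bigcup_n A n).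
Proof.
move=> /(_ _)/cid2-/all_sig2[F cF AE].
exists (fun s => if s is i :: s' then F i s' else setT).
  by case=> [|i s]; [exact: closedT|exact: cF].
apply/seteqP; split=> [x [i _]|x [sg H]].
  rewrite AE => -[sg H]; exists (fun k => if k is k'.+1 then sg k' else i).
  by case=> [|k]; [|rewrite mkseq_cons; exact: H].
exists (sg 0%N) => //; rewrite AE; exists (sg \o S) => k.
suff -> : mkseq (sg \o S) k = map sg (iota 1 k) by exact: (H k.+1).
by rewrite (iotaDl 1 0 k : iota 1 k = _) -map_comp.
Qed.

(** One branch encodes a sequence of branches through the pairing of natural
    numbers; the closed set attached to s collects all the conditions that the
    entries of s already determine. *)
Lemma suslin_bigcap (A : (set R)^nat) :
  (forall n, suslin (A n)) -> suslin (\bigcap_n A n).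
Proof.
move=> /(_ _)/cid2-/all_sig2[F cF AE].
pose pr (i j : nat) : nat := pickle (i, j).
exists (fun s => [set x | forall i k, (forall j, (j < k)%N -> (pr i j < size s)%N) ->
    F i (mkseq (fun j => nth 0%N s (pr i j)) k) x]).
  move=> s.
  have -> : [set x | forall i k, (forall j, (j < k)%N -> (pr i j < size s)%N) ->
      F i (mkseq (fun j => nth 0%N s (pr i j)) k) x] =
    \bigcap_(p in [set p : nat * nat | forall j, (j < p.2)%N -> (pr p.1 j < size s)%N])
      F p.1 (mkseq (fun j => nth 0%N s (pr p.1 j)) p.2).
    by apply/seteqP; split=> x H => [[i k] /= /H|i k hk]; last exact: (H (i, k)).
  by apply: closed_bigI => p _; exact: cF.
apply/seteqP; split=> [x Ax|x [sg H] i _].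
  have /choice[g Hg] : forall i, exists sg : nat -> nat, forall k, F i (mkseq sg k) x.
    by move=> i; have := Ax i I; rewrite AE.
  exists (fun n => if unpickle n is Some p then g p.1 p.2 else 0%N) => m i k hk.
  suff -> : mkseq (fun j => nth 0%N (mkseq
     (fun n => if unpickle n is Some p then g p.1 p.2 else 0%N) m) (pr i j)) k =
     mkseq (g i) k by exact: Hg.
  apply/eq_in_map => j; rewrite mem_iota add0n => /hk; rewrite size_mkseq => h.
  by rewrite nth_mkseq// /pr pickleK.
rewrite AE; exists (fun j => sg (pr i j)) => k.
pose m := (\max_(j < k) (pr i j).+1)%N.
have hm j : (j < k)%N -> (pr i j < m)%N.
  by move=> jk; exact: (@leq_bigmax_cond _ predT (fun j : 'I_k => (pr i j).+1) (Ordinal jk)).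
have := H m i k; rewrite size_mkseq => /(_ hm).
congr (F i _ x); apply/eq_in_map => j; rewrite mem_iota add0n => /hm h.
by rewrite nth_mkseq.
Qed.

(** The sets that are Suslin together with their complements form a
    sigma-algebra, which contains the closed half-lines. *)
Lemma measurable_suslin (A : set R) : measurable A -> suslin A.
Proof.
move=> mA; suff : suslin A /\ suslin (~` A) by case.
have {mA} : (@measurable_realfun.RGenCInfty.G R).-sigma.-measurable A.
  by rewrite -measurable_realfun.RGenCInfty.measurableE.
apply: (@smallest_sub _ _ _ [set A | suslin A /\ suslin (~` A)]); first split=> /=.
- by rewrite setC0; split; apply: suslin_closed; [exact: closed0|exact: closedT].
- by move=> B [sB sCB]; rewrite setTD setCK; split.
- move=> B H; split; first by apply: suslin_bigcup => n; exact: (H n).1.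
  by rewrite setC_bigcup; apply: suslin_bigcap => n; exact: (H n).2.
move=> _ [x ->]; split; first by apply/suslin_closed/interval_closed.
rewrite setCitvr.
have -> : (`]-oo, x[%classic : set R) = \bigcup_n `]-oo, x - n.+1%:R^-1]%classic.
  apply/seteqP; split=> [y /=|y [n _] /=]; rewrite !in_itv /=.
    move=> yx; have d0 : 0 < x - y by rewrite subr_gt0.
    exists (Num.truncn (x - y)^-1) => //=; rewrite in_itv /= lerBrDr -lerBrDl.
    rewrite -[leRHS]invrK lef_pV2 ?posrE ?invr_gt0 ?ltr0Sn// ltW//.
    by have /andP[] : _ := truncn_itv (ltW (etrans (invr_gt0 (x - y)) d0)).
  by move=> /le_lt_trans; apply; rewrite gtrBl invr_gt0 ltr0Sn.
by apply: suslin_bigcup => n; apply/suslin_closed/interval_closed.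
Qed.

End suslin.

Section capacitability.
Context {R : realType}.
Variable rho : R.
Hypothesis rho_gt0 : 0 < rho.
Local Notation net_content := (@net_content R rho).
Local Notation cost_le := (@cost_le R rho).

(** Dyadic intervals are half-open.  A node and its two neighbours cover an
    open set that contains the interval of the node, at three times the weight. *)
Definition thicken (U : set (nat * nat)) : set (nat * nat) :=
  [set q | [\/ U q, U (q.1, q.2.+1) | (0 < q.2)%N /\ U (q.1, q.2.-1)]].

Lemma cost_thicken U b : cost_le U b -> cost_le (thicken U) (3 * b).
Proof.
move=> cU L uL hL.
have key (P : pred (nat * nat)) (g : nat * nat -> nat * nat) :
   {in P &, injective g} -> (forall q, P q -> U (g q)) -> (forall q, (g q).1 = q.1) ->
   \sum_(q <- L | P q) rho ^+ q.1 <= b.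
  move=> gi gU g1; rewrite -big_filter.
  rewrite (eq_bigr (fun q => rho ^+ (g q).1)); last by move=> q _; rewrite g1.
  rewrite -(big_map g predT (fun q => rho ^+ q.1)); apply: cU.
    rewrite map_inj_in_uniq ?filter_uniq// => p q; rewrite !mem_filter.
    by move=> /andP[Pp _] /andP[Pq _]; exact: gi.
  by move=> q /mapP[p]; rewrite mem_filter => /andP[/gU Ug _] ->.
pose P0 q := `[< U q >].
pose P1 q := `[< U (q.1, q.2.+1) >].
pose P2 q := (0 < q.2)%N && `[< U (q.1, q.2.-1) >].
have h0 : \sum_(q <- L | P0 q) rho ^+ q.1 <= b.
  by apply: (key _ id) => // q /asboolP.
have h1 : \sum_(q <- L | P1 q) rho ^+ q.1 <= b.
  by apply: (key _ (fun q => (q.1, q.2.+1))) => // [[a c] [d f] _ _ [-> ->]//|q /asboolP].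
have h2 : \sum_(q <- L | P2 q) rho ^+ q.1 <= b.
  apply: (key _ (fun q => (q.1, q.2.-1))) => //; last by move=> q /andP[_ /asboolP].
  move=> [a c] [d e]; rewrite !unfold_in => /andP[/= c0 _] /andP[/= e0 _] [-> E].
  by congr (_, _); lia.
have -> : 3 * b = b + b + b by ring.
apply: le_trans (lerD (lerD h0 h1) h2).
rewrite [X in _ <= X + _ + _]big_mkcond [X in _ <= _ + X + _]big_mkcond.
rewrite [X in _ <= _ + X]big_mkcond -!big_split /=.
rewrite !big_seq; apply: ler_sum => q /hL Hq.
have r0 : 0 <= rho ^+ q.1 by rewrite exprn_ge0 ?ltW.
have ge0 (c : bool) : 0 <= (if c then rho ^+ q.1 else 0) by case: c.
case: Hq => [H|H|[H H']].
- by rewrite {1}/P0 asboolT// -addrA lerDl addr_ge0.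
- by rewrite {1}/P1 asboolT// addrAC lerDr addr_ge0.
- by rewrite {1}/P2 H asboolT//= lerDr addr_ge0.
Qed.

Definition thicken_node (q : nat * nat) : set R :=
  `](q.2%:R - 1) / 2 ^+ q.1, (q.2%:R + 2) / 2 ^+ q.1[%classic.

Lemma thicken_node_idx n x : 0 <= x -> thicken_node (n, dyadic_idx n x) x.
Proof.
move=> x0; rewrite /thicken_node /= in_itv /=.
have /andP[l u] := @dyadic_idx_itv R n x x0.
rewrite ltr_pdivrMr ?exprn_gt0// ltr_pdivlMr ?exprn_gt0//.
rewrite -[_.+1%:R]natr1 in u; apply/andP; split; lra.
Qed.

Lemma thicken_node_thicken U q x : 0 <= x -> U q -> thicken_node q x -> thicken U (q.1, dyadic_idx q.1 x).
Proof.
case: q => n k x0 Uk; rewrite /thicken_node /= in_itv /=.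
have /andP[l u] := @dyadic_idx_itv R n x x0; set t := dyadic_idx n x in l u *.
rewrite ltr_pdivrMr ?exprn_gt0// ltr_pdivlMr ?exprn_gt0// => /andP[a b].
have tk : (t < k + 2)%N by rewrite -(ltr_nat R) natrD (le_lt_trans l).
have kt : (k < t + 2)%N.
  rewrite -(ltr_nat R) natrD; rewrite -[_.+1%:R]natr1 in u; lra.
have [->|[E|E]] : t = k \/ (k = t.+1 \/ t = k.+1) by lia.
- by constructor 1.
- by constructor 2; rewrite /= -E.
- by constructor 3; rewrite /= E.
Qed.

(** There are finitely many sequences of length k bounded by h. *)
Lemma closed_prefix_union (h : nat -> nat) (k : nat) (G : seq nat -> set R) :
  (forall s, closed (G s)) ->
  closed [set x | exists s, [/\ size s = k,
    (forall i, (i < k)%N -> (nth 0%N s i <= h i)%N) & G s x]].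
Proof.
elim: k G => [|k IH] G cG.
  have -> : [set x | exists s, [/\ size s = 0%N,
    (forall i, (i < 0)%N -> (nth 0%N s i <= h i)%N) & G s x]] = G [::]; last exact: cG.
  by apply/seteqP; split=> [x [s [/size0nil -> _]]//|x Gx]; exists [::].
pose G' s := \big[setU/set0]_(v <- iota 0 (h k).+1) G (rcons s v).
suff -> : [set x | exists s, [/\ size s = k.+1,
    (forall i, (i < k.+1)%N -> (nth 0%N s i <= h i)%N) & G s x]] =
  [set x | exists s, [/\ size s = k,
    (forall i, (i < k)%N -> (nth 0%N s i <= h i)%N) & G' s x]].
  by apply: IH => s; apply: closed_bigsetU => v _; exact: cG.
apply/seteqP; split=> x [s [ss hs Gs]].
  elim/last_ind: s ss hs Gs => // s v _; rewrite size_rcons => -[ss] hs Gs.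
  exists s; split=> // [i ik|].
    by have := hs i (ltnW ik); rewrite nth_rcons ss ik.
  rewrite /G' -bigcup_seq; exists v => //.
  suff : v \in iota 0 (h k).+1 by []; rewrite mem_iota add0n ltnS.
  by have := hs k (leqnn _); rewrite nth_rcons ss ltnn eqxx.
move: Gs; rewrite /G' -bigcup_seq => -[v vI Gv].
have vh : (v <= h k)%N by have : v \in iota 0 (h k).+1 by []; rewrite mem_iota.
exists (rcons s v); split=> //; first by rewrite size_rcons ss.
move=> i; rewrite ltnS leq_eqVlt nth_rcons ss => /orP[/eqP->|ik].
  by rewrite ltnn eqxx.
by rewrite ik; exact: hs.
Qed.

(** Bounding the entries of the branches one after the other, by
    [net_content_bigcup], costs no more than the slack between c and the content.
    With all entries bounded by h, the sets KK k of points that pass the tests of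
    the scheme up to level k, along some branch bounded by h, are closed and
    decreasing, and by [konig] their intersection is contained in A.  An open
    cover of the intersection covers one of the KK k, hence a set of content > c;
    the factor 3 comes from making dyadic covers open. *)
Lemma capacitability (A : set R) c : A `<=` [set x | 0 <= x < 1] ->
  suslin A -> c < net_content A ->
  exists K : set R, [/\ closed K, K `<=` A &
    forall U b, covers U K -> cost_le U b -> c <= 3 * b].
Proof.
move=> A01 [F cF AE] cA.
pose AA (b : seq nat) := [set x | exists2 sg : nat -> nat,
   (forall i, (i < size b)%N -> (sg i <= nth 0%N b i)%N) & forall k, F (mkseq sg k) x].
have AAA b : AA b `<=` A by rewrite AE => x [sg _ H]; exists sg.
have step b : c < net_content (AA b) -> exists v, c < net_content (AA (rcons b v)).
  move=> cb; apply: contrapT => /forallNP H.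
  suff : net_content (AA b) <= c by rewrite leNgt cb.
  have -> : AA b = \bigcup_v AA (rcons b v).
    apply/seteqP; split=> [x [sg hs Fs]|x [v _ [sg hs Fs]]].
      exists (sg (size b)) => //; exists sg => // i.
      rewrite size_rcons nth_rcons ltnS leq_eqVlt => /orP[/eqP->|ib].
        by rewrite ltnn eqxx.
      by rewrite ib; exact: hs.
    exists sg => // i ib; have := hs i; rewrite size_rcons nth_rcons ib; apply.
    exact: ltnW.
  apply: net_content_bigcup => //.
  - move=> v x [sg hs Fs]; exists sg => // i ib.
    apply: leq_trans (hs i _) _; first by rewrite !size_rcons in ib *.
    by rewrite !nth_rcons; case: ifP => // _; case: ifP.
  - by move=> v; apply: subset_trans A01; exact: AAA.
  - by move=> v; rewrite leNgt; apply/negP; exact: H.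
have /choice[f Hf] : forall b, exists v, c < net_content (AA b) -> c < net_content (AA (rcons b v)).
  move=> b; have [/step[v dv]|n] := pselect (c < net_content (AA b)); first by exists v.
  by exists 0%N.
pose S := fix S k := if k is k'.+1 then rcons (S k') (f (S k')) else [::].
pose h k := f (S k).
have SE k : S k = mkseq h k by elim: k => // k IH; rewrite mkseqS -IH.
have cS k : c < net_content (AA (S k)).
  elim: k => [|k IH]; last exact: Hf.
  suff -> : AA (S 0%N) = A by [].
  by rewrite AE; apply/seteqP; split=> x [sg]; [exists sg|move=> H; exists sg].
pose KK k := [set x | exists s, [/\ size s = k,
    (forall i, (i < k)%N -> (nth 0%N s i <= h i)%N) &
    (\bigcap_(j in [set j | (j <= k)%N]) F (take j s)) x]].
have cKK k : closed (KK k).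
  by apply: closed_prefix_union => s; apply: closed_bigI => j _; exact: cF.
have KKS k : KK k.+1 `<=` KK k.
  move=> x [s [ss hs Hs]]; exists (take k s); split.
  - by rewrite size_take ss ltnSn.
  - by move=> i ik; rewrite nth_take//; apply: hs; exact: ltnW.
  - move=> j /= jk; rewrite take_takel//; apply: Hs => /=; exact: ltnW.
have KKmono m n : (m <= n)%N -> KK n `<=` KK m.
  move=> /subnK <-; elim: (n - m)%N => // d IH; apply: subset_trans IH; exact: KKS.
have AKK k : AA (S k) `<=` KK k.
  move=> x [sg hs Fs]; exists (mkseq sg k); split.
  - exact: size_mkseq.
  - move=> i ik; rewrite nth_mkseq//; have := hs i.
    by rewrite SE size_mkseq nth_mkseq//; apply.
  - move=> j /= jk; rewrite /mkseq -map_take take_iota (minn_idPl jk); exact: Fs.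
have KA : \bigcap_k KK k `<=` A.
  move=> x Kx; rewrite AE.
  pose T s := (forall i, (i < size s)%N -> (nth 0%N s i <= h i)%N) /\
     (forall j, (j <= size s)%N -> F (take j s) x).
  have [s v [hs Fs]|k|sg Hsg] := konig T h.
  - split; last first.
      by have := hs (size s); rewrite size_rcons nth_rcons ltnn eqxx; apply.
    split=> [i i_s|j js].
      by have := hs i; rewrite size_rcons nth_rcons i_s; apply; exact: ltnW.
    have := Fs j; rewrite size_rcons -cats1 take_cat.
    move: js; rewrite leq_eqVlt => /orP[/eqP->|js].
      by rewrite ltnn subnn take0 cats0 take_size; apply; exact: ltnW.
    by rewrite js; apply; exact: (leqW (ltnW js)).
  - by have [s [ss hs Hs]] := Kx k I; exists s => //; split; rewrite ss.
  - exists sg => k; have [_ /(_ k)] := Hsg k.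
    by rewrite size_mkseq take_oversize ?size_mkseq//; apply.
exists (\bigcap_k KK k); split=> //; first by apply: closed_bigI.
move=> U b cU cb.
have := @segment_compact R 0 1; rewrite compact_cover.
(* Open cover of [0, 1] by the thickened nodes of U and the complements of the KK k. *)
pose f' (i : (nat * nat) + nat) : set R := match i with inl q => thicken_node q | inr k => ~` KK k end.
move=> /(_ _ [set i | if i is inl q then U q else True] f').
case.
- case=> [q _|k _] /=; first exact: interval_open.
  by rewrite openC; exact: cKK.
- move=> x /=; rewrite in_itv /= => /andP[x0 _].
  have [Kx|nK] := pselect ((\bigcap_k KK k) x).
    have [n Un] := cU x Kx; exists (inl (n, dyadic_idx n x)) => //.
    exact: thicken_node_idx.
  have /existsNP[k /not_implyP[_ nk]] := nK; by exists (inr k).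
- move=> D' D'U cov.
  pose m := \max_(i <- finmap.enum_fset D') (if i is inr k then k else 0)%N.
  apply: (le_trans (ltW (cS m))); apply: (@net_content_le _ _ _ (thicken U)); last exact: cost_thicken.
  move=> x AAx; have /andP[x0 x1] := A01 _ (AAA _ _ AAx).
  have [|[q|k] /= iD fx] := cov x; first by rewrite /= in_itv /= x0 ltW.
    exists q.1; apply: thicken_node_thicken => //.
    by have := D'U _ iD; rewrite inE.
  exfalso; apply: fx; apply: (KKmono _ m); last exact: AKK.
  exact: (@leq_bigmax_seq _ (finmap.enum_fset D') predT (fun i => if i is inr k then k else 0)%N (inr k)).
Qed.

End capacitability.

(** * Frostman weights on a dyadic grid *)

Lemma le_sum_uniq_sub {R : realType} (T : eqType) (L L' : seq T) (f : T -> R) :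
  (forall q, 0 <= f q) -> uniq L' -> {subset L' <= L} ->
  \sum_(q <- L') f q <= \sum_(q <- L) f q.
Proof.
move=> f0; elim: L' L => [|q L' IH] L /=; first by rewrite big_nil sumr_ge0.
move=> /andP[qL' uL'] sub; have qL : q \in L by apply: sub; rewrite mem_head.
rewrite big_cons (perm_big _ (perm_to_rem qL)) big_cons lerD2l; apply: IH => // r rL'.
have : r \in L by apply: sub; rewrite inE rL' orbT.
rewrite (perm_mem (perm_to_rem qL)) inE => /orP[/eqP E|//].
by move: qL'; rewrite -E rL'.
Qed.

Section frostman.
Context {R : realType}.
Variable rho : R.
Hypothesis rho_gt0 : 0 < rho.

(** Max-flow min-cut on the binary tree below the node (n - m, j), by
    induction from the leaves: the weights of the two children are added, and
    scaled down to total rho^(n - m) when they exceed this capacity.  The list L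
    is the corresponding cut: the node itself after scaling, and otherwise the
    cuts of the two children. *)
Lemma frostman_tree (K : set R) (n m j : nat) : K `<=` [set x | 0 <= x < 1] ->
  (m <= n)%N -> exists (p : nat -> R) (L : seq (nat * nat)),
  [/\ forall i, 0 <= p i,
      forall i, p i != 0 -> (i %/ 2 ^ m)%N = j /\ exists2 x, K x & dyadic_idx n x = i,
      forall k j', (k <= n)%N -> (n - m <= k)%N ->
        \sum_(i < 2 ^ n | (i %/ 2 ^ (n - k))%N == j') p i <= rho ^+ k,
      forall x, K x -> dyadic_idx (n - m) x = j -> exists2 q, q \in L & q.2 = dyadic_idx q.1 x
    & \sum_(q <- L) rho ^+ q.1 <= \sum_(i < 2 ^ n) p i].
Proof.
have half a : (2 * a %/ 2 = a)%N /\ ((2 * a).+1 %/ 2 = a)%N by split; lia.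
move=> K01; elim: m j => [|m IH] j mn.
  rewrite subn0; have rn0 : 0 <= rho ^+ n by rewrite exprn_ge0// ltW.
  have [[x Kx xj]|nx] := pselect (exists2 x, K x & dyadic_idx n x = j); last first.
    exists (fun=> 0), [::]; split=> //.
    - by move=> i; rewrite eqxx.
    - by move=> k j' _ _; rewrite big1// exprn_ge0// ltW.
    - by move=> x Kx xj; case: nx; exists x.
    - by rewrite big_nil big1.
  have jn : (j < 2 ^ n)%N by rewrite -xj; apply: dyadic_idx_lt; exact: K01.
  have E : \sum_(i < 2 ^ n) (if i == j :> nat then rho ^+ n else 0) = rho ^+ n.
    by rewrite -big_mkcond (big_pred1 (Ordinal jn))//= => i; rewrite -val_eqE.
  exists (fun i => if i == j then rho ^+ n else 0), [:: (n, j)]; split.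
  - by move=> i; case: ifP.
  - move=> i; case: ifP => [/eqP -> _|_]; last by rewrite eqxx.
    by rewrite expn0 divn1; split=> //; exists x.
  - move=> k j' kn nk; have -> : k = n by lia.
    rewrite -[leRHS]E [leLHS]big_mkcond; apply: ler_sum => i _.
    by case: (_ == j') => //; case: ifP.
  - by move=> y Ky yj; exists (n, j); rewrite ?mem_head//= yj.
  - by rewrite big_seq1 E.
have mn' : (m <= n)%N by exact: ltnW.
have [p0 [L0 [p0_ge0 p0s p0F L0c L0p]]] := IH (2 * j)%N mn'.
have [p1 [L1 [p1_ge0 p1s p1F L1c L1p]]] := IH (2 * j).+1%N mn'.
pose p i := p0 i + p1 i.
have p_ge0 i : 0 <= p i by rewrite addr_ge0.
pose t := \sum_(i < 2 ^ n) p i.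
pose r := rho ^+ (n - m.+1).
have r_gt0 : 0 < r by rewrite exprn_gt0.
have t_ge0 : 0 <= t by rewrite sumr_ge0.
have ps i : p i != 0 -> (i %/ 2 ^ m.+1)%N = j /\ exists2 x, K x & dyadic_idx n x = i.
  move=> pi; have : p0 i != 0 \/ p1 i != 0.
    apply/orP; apply: contraNT pi; rewrite negb_or !negbK => /andP[/eqP e0 /eqP e1].
    by rewrite /p e0 e1 addr0.
  have d : (i %/ 2 ^ m.+1)%N = (i %/ 2 ^ m %/ 2)%N by rewrite expnSr divnMA.
  have [h0 h1] := half j; by case=> [/p0s|/p1s] [E ex]; split=> //; rewrite d E.
have pF k j' : (k <= n)%N -> (n - m <= k)%N ->
    \sum_(i < 2 ^ n | (i %/ 2 ^ (n - k))%N == j') p i <= rho ^+ k.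
  move=> kn nk.
  have d i : (i %/ 2 ^ m)%N = (i %/ 2 ^ (n - k) %/ 2 ^ (m - (n - k)))%N.
    by rewrite -divnMA -expnD; congr (_ %/ 2 ^ _)%N; lia.
  have [e|ne] := eqVneq (j' %/ 2 ^ (m - (n - k)))%N (2 * j)%N.
    apply: le_trans (p0F k j' kn nk); apply: ler_sum => i /eqP ij.
    have [p1i|/p1s[E _]] := eqVneq (p1 i) 0; first by rewrite /p p1i addr0.
    by move: E; rewrite d ij e; lia.
  apply: le_trans (p1F k j' kn nk); apply: ler_sum => i /eqP ij.
  have [p0i|/p0s[E _]] := eqVneq (p0 i) 0; first by rewrite /p p0i add0r.
  by move: E; rewrite d ij => /eqP; rewrite (negbTE ne).
have pt k j' : \sum_(i < 2 ^ n | (i %/ 2 ^ (n - k))%N == j') p i <= t.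
  rewrite [leLHS]big_mkcond; apply: ler_sum => i _; by case: ifP.
have [tr|rt] := leP t r.
  exists p, (L0 ++ L1); split=> //.
  - move=> k j' kn nk.
    have [nk'|kn'] := leqP (n - m) k; first exact: pF.
    apply: le_trans (pt _ _) _; rewrite (_ : k = n - m.+1)%N//; apply/eqP.
    by rewrite eqn_leq nk andbT -ltnS subnSK.
  - move=> x Kx xj; have /andP[x0 _] := K01 _ Kx.
    have d : dyadic_idx (n - m.+1) x = (dyadic_idx (n - m) x %/ 2)%N.
      rewrite (@dyadic_idx_div _ (n - m.+1) (n - m))//; last by lia.
      by congr (_ %/ _)%N; rewrite (_ : n - m - (n - m.+1) = 1)%N//; lia.
    have [e|e] : dyadic_idx (n - m) x = (2 * j)%N \/ dyadic_idx (n - m) x = (2 * j).+1%N by lia.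
      by have [q qL qx] := L0c _ Kx e; exists q => //; rewrite mem_cat qL.
    by have [q qL qx] := L1c _ Kx e; exists q => //; rewrite mem_cat qL orbT.
  - by rewrite big_cat /= big_split /= lerD.
have t_gt0 : 0 < t by exact: lt_trans rt.
have rt1 : r / t <= 1 by rewrite ler_pdivrMr// mul1r ltW.
exists (fun i => r / t * p i), [:: ((n - m.+1)%N, j)]; split.
- by move=> i; rewrite mulr_ge0// divr_ge0// ltW.
- by move=> i; rewrite mulf_eq0 negb_or => /andP[_ /ps].
- move=> k j' kn nk; rewrite -mulr_sumr.
  have [nk'|kn'] := leqP (n - m) k.
    apply: le_trans (pF k j' kn nk'); rewrite ler_piMl// sumr_ge0//.
  have -> : k = (n - m.+1)%N by apply/eqP; rewrite eqn_leq nk andbT -ltnS subnSK.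
  rewrite -/r mulrAC ler_pdivrMr// ler_pM2l//.
- by move=> x Kx xj; exists ((n - m.+1)%N, j); rewrite ?mem_head//= xj.
- by rewrite big_seq1 /= -mulr_sumr -/t divfK// gt_eqF.
Qed.

Lemma discrete_frostman (K : set R) (c : R) (n : nat) : K `<=` [set x | 0 <= x < 1] ->
  (forall U b, covers U K -> cost_le rho U b -> c <= b) ->
  exists p : nat -> R,
  [/\ forall i, 0 <= p i,
      forall i, p i != 0 -> exists2 x, K x & dyadic_idx n x = i,
      forall k j, (k <= n)%N ->
        \sum_(i < 2 ^ n | (i %/ 2 ^ (n - k))%N == j) p i <= rho ^+ k
    & c <= \sum_(i < 2 ^ n) p i].
Proof.
move=> K01 Kc; have [p [L [p0 ps pF Lc Lp]]] := frostman_tree K n n 0 K01 (leqnn n).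
exists p; split=> //.
- by move=> i /ps[].
- by move=> k j kn; apply: pF => //; rewrite subnn.
- apply: le_trans Lp; apply: (Kc [set q | q \in L]).
    move=> x Kx; have := Lc x Kx; rewrite subnn => -[|[a b] abL /= e].
      by have := @dyadic_idx_lt R 0 x (K01 _ Kx); case: (dyadic_idx 0 x).
    by exists a; rewrite -e.
  move=> L' uL' sub; apply: le_sum_uniq_sub => // q; by rewrite exprn_ge0// ltW.
Qed.

End frostman.

(** * Elementary trigonometric and quadratic inequalities *)

Section trig.
Context {R : realType}.
Implicit Types x t : R.

Lemma norm_sin_le x : `|sin x| <= `|x|.
Proof.
wlog x0 : x / 0 <= x.
  move=> H; have [/H//|/ltW] := leP 0 x; rewrite -oppr_ge0 => /H.
  by rewrite sinN !normrN.
have [c _] := MVT_segment (f := sin) (df := cos) x0 (fun x _ => is_derive_sin x)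
   (continuous_subspaceT (@continuous_sin R)).
rewrite sin0 !subr0 => ->; rewrite normrM ler_piMl//; exact: cos_max.
Qed.

Lemma cos_half x : 1 - cos x = 2 * sin (x / 2) ^+ 2.
Proof.
have -> : cos x = cos (x / 2 + x / 2) by congr cos; field.
rewrite cosD; have := cos2Dsin2 (x / 2); lra.
Qed.

Lemma one_sub_cos_le x : 1 - cos x <= x ^+ 2 / 2.
Proof.
rewrite cos_half; have : sin (x / 2) ^+ 2 <= (x / 2) ^+ 2; last by lra.
rewrite -[leLHS]real_normK ?num_real// -[leRHS]real_normK ?num_real//.
by rewrite ler_pXn2r ?nnegrE// norm_sin_le.
Qed.

Lemma cos_ge_half x : `|x| <= 1 -> 1 / 2 <= cos x.
Proof.
move=> x1; have := one_sub_cos_le x.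
have : x ^+ 2 <= 1 by rewrite -real_normK ?num_real// expr_le1.
lra.
Qed.

Lemma one_sub_cos_ge x : `|x| <= 1 -> x ^+ 2 / 4 <= 1 - cos x.
Proof.
wlog x0 : x / 0 <= x.
  move=> H; have [/H//|/ltW] := leP 0 x; rewrite -oppr_ge0 => /H.
  by rewrite cosN sqrrN normrN.
rewrite ger0_norm// => x1; rewrite cos_half.
have x20 : 0 <= x / 2 by rewrite divr_ge0.
have [c cx] := MVT_segment (f := sin) (df := cos) x20 (fun x _ => is_derive_sin x)
   (continuous_subspaceT (@continuous_sin R)).
rewrite sin0 !subr0 => ->; move: cx; rewrite in_itv /= => /andP[c0 cx].
have c2 : c ^+ 2 <= 1 / 4.
  have -> : 1 / 4 = (1 / 2) ^+ 2 :> R by field.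
  by rewrite ler_pXn2r ?nnegrE//; lra.
have cc : 7 / 8 <= cos c by have := one_sub_cos_le c; lra.
have : (7 / 8) ^+ 2 <= cos c ^+ 2 by rewrite ler_pXn2r ?nnegrE//; lra.
move=> h; have x2 : 0 <= x ^+ 2 by exact: sqr_ge0.
have -> : (cos c * (x / 2)) ^+ 2 = cos c ^+ 2 * x ^+ 2 / 4 by field.
nra.
Qed.

(** A chord of the unit circle is shorter than the arc. *)
Lemma chord_sq s t : (cos s - cos t) ^+ 2 + (sin s - sin t) ^+ 2 <= (s - t) ^+ 2.
Proof.
have := one_sub_cos_le (s - t); rewrite cosB.
have := cos2Dsin2 s; have := cos2Dsin2 t; nra.
Qed.

Lemma sum_sqr_le (T : Type) (J : seq T) (a : T -> R) :
  (\sum_(j <- J) a j) ^+ 2 <= (size J)%:R * \sum_(j <- J) a j ^+ 2.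
Proof.
rewrite expr2 big_distrlr /=.
apply: (@le_trans _ _ (\sum_(i <- J) \sum_(j <- J) (a i ^+ 2 / 2 + a j ^+ 2 / 2))).
  apply: ler_sum => i _; apply: ler_sum => j _.
  have := sqr_ge0 (a i - a j); nra.
set S := \sum_(j <- J) a j ^+ 2.
have E i : \sum_(j <- J) (a i ^+ 2 / 2 + a j ^+ 2 / 2) =
    (size J)%:R * (a i ^+ 2 / 2) + S / 2.
  by rewrite big_split /= big_const_seq count_predT iter_addr_0 mulr_natl /S mulr_suml.
rewrite (eq_bigr _ (fun i _ => E i)) big_split /= [X in _ + X]big_const_seq.
rewrite count_predT iter_addr_0 -mulr_sumr -mulr_suml -/S.
by rewrite -[S / 2 *+ _]mulr_natl -mulrDr -splitr.
Qed.

End trig.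

(** * Squared exponential sums and collisions *)

Section energy.
Context {R : realType}.

(** The squared modulus of the exponential sum with terms
    p i * exp (sqrt (-1) * f i). *)
Definition expsum2 {I : finType} (p f : I -> R) : R :=
  (\sum_i p i * cos (f i)) ^+ 2 + (\sum_i p i * sin (f i)) ^+ 2.

Lemma expsum2_ge0 (I : finType) (p f : I -> R) : 0 <= expsum2 p f.
Proof. by rewrite addr_ge0 ?sqr_ge0. Qed.

Lemma eq_expsum2 (I : finType) (p f g : I -> R) : f =1 g -> expsum2 p f = expsum2 p g.
Proof. by move=> fg; rewrite /expsum2; under eq_bigr do rewrite fg; under [in X in _ + X]eq_bigr do rewrite fg. Qed.

Lemma expsum2_opp (I : finType) (p f : I -> R) : expsum2 p (fun i => - f i) = expsum2 p f.
Proof.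
rewrite /expsum2; congr (_ + _).
  by under eq_bigr do rewrite cosN.
under eq_bigr do rewrite sinN mulrN.
by rewrite sumrN sqrrN.
Qed.

Lemma expsum2_pair (I : finType) (p f : I -> R) :
  expsum2 p f = \sum_i \sum_j p i * p j * cos (f i - f j).
Proof.
rewrite /expsum2 !expr2 !big_distrlr /= -big_split /=; apply: eq_bigr => i _.
rewrite -big_split /=; apply: eq_bigr => j _; rewrite cosB; ring.
Qed.

(** The exponential sum factors, and the modulus is multiplicative. *)
Lemma expsum2_prod (I J : finType) (p f : I -> R) (q g : J -> R) :
  expsum2 (fun x : I * J => p x.1 * q x.2) (fun x => f x.1 + g x.2) = expsum2 p f * expsum2 q g.
Proof.
set A := \sum_i p i * cos (f i); set B := \sum_i p i * sin (f i).
set C := \sum_j q j * cos (g j); set D := \sum_j q j * sin (g j).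
have E1 : \sum_(x : I * J) p x.1 * q x.2 * cos (f x.1 + g x.2) = A * C - B * D.
  rewrite -(pair_bigA _ (fun i j => p i * q j * cos (f i + g j))) /= !big_distrlr /= -sumrB.
  apply: eq_bigr => i _; rewrite -sumrB; apply: eq_bigr => j _; rewrite cosD; ring.
have E2 : \sum_(x : I * J) p x.1 * q x.2 * sin (f x.1 + g x.2) = A * D + B * C.
  rewrite -(pair_bigA _ (fun i j => p i * q j * sin (f i + g j))) /= !big_distrlr /= -big_split /=.
  apply: eq_bigr => i _; rewrite -big_split; apply: eq_bigr => j _ /=; rewrite sinD; ring.
by rewrite /expsum2 E1 E2 -/A -/B -/C -/D; ring.
Qed.

Lemma expsum2_le (I : finType) (p f : I -> R) : (forall i, 0 <= p i) ->
  expsum2 p f <= (\sum_i p i) ^+ 2.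
Proof.
move=> p0; rewrite expsum2_pair expr2 big_distrlr /=; apply: ler_sum => i _.
by apply: ler_sum => j _; rewrite ler_piMr ?mulr_ge0// cos_le1.
Qed.

(** The square of the Dirichlet kernel, that is, N times the Fejer kernel. *)
Definition dirichlet2 (N : nat) (t : R) : R := expsum2 (fun _ : 'I_N => 1) (fun l => l%:R * t).

Lemma dirichlet2_pair N t : dirichlet2 N t = \sum_(l < N) \sum_(l' < N) cos ((l%:R - l'%:R) * t).
Proof.
rewrite /dirichlet2 expsum2_pair; apply: eq_bigr => l _; apply: eq_bigr => l' _.
by rewrite !mul1r mulrBl.
Qed.

Lemma dirichlet2_ge0 N t : 0 <= dirichlet2 N t. Proof. exact: expsum2_ge0. Qed.

Lemma dirichlet2_le N t : dirichlet2 N t <= N%:R ^+ 2.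
Proof.
apply: le_trans (expsum2_le _ _ _ _) _ => //.
by rewrite sumr_const card_ord.
Qed.

Lemma dirichlet2_small N t : `|N%:R * t| <= 1 -> N%:R ^+ 2 / 4 <= dirichlet2 N t.
Proof.
move=> Nt; rewrite /dirichlet2 /expsum2.
have h : N%:R / 2 <= \sum_(i < N) 1 * cos (i%:R * t).
  have -> : N%:R / 2 = \sum_(i < N) (1 / 2 : R).
    by rewrite sumr_const card_ord mul1r -[RHS]mulr_natl.
  apply: ler_sum => i _; rewrite [1 * cos _]mul1r; apply: cos_ge_half.
  apply: le_trans Nt; rewrite !normrM ler_wpM2r// !normr_nat ler_nat.
  by apply: ltnW; exact: ltn_ord.
have := sqr_ge0 (\sum_(i < N) 1 * sin (i%:R * t)).
have N0 : 0 <= N%:R / 2 :> R by rewrite divr_ge0.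
have : (N%:R / 2) ^+ 2 <= (\sum_(i < N) 1 * cos (i%:R * t)) ^+ 2.
  by rewrite ler_pXn2r ?nnegrE// (le_trans N0).
have -> : (N%:R / 2) ^+ 2 = N%:R ^+ 2 / 4 :> R by field.
lra.
Qed.

(** Multiplying the geometric sum of the exp (sqrt (-1) * l * t) by
    exp (sqrt (-1) * t) - 1 leaves a quantity of modulus at most 2. *)
Lemma dirichlet2_decay N t : `|t| <= 1 -> dirichlet2 N t * t ^+ 2 <= 8.
Proof.
move=> t1; rewrite /dirichlet2 /expsum2.
under eq_bigr do rewrite mul1r.
under [in X in _ + X]eq_bigr do rewrite mul1r.
set C := \sum_(i < N) cos (i%:R * t); set S := \sum_(i < N) sin (i%:R * t).
have [E1 E2] : (cos t - 1) * C - sin t * S = cos (N%:R * t) - 1 /\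
    (cos t - 1) * S + sin t * C = sin (N%:R * t).
  rewrite /C /S {C S}; elim: N => [|N [IH1 IH2]].
    by rewrite !big_ord0 mul0r cos0 sin0; split; ring.
  rewrite !big_ord_recr /= -[N.+1%:R]natr1 [(_ + 1) * t]mulrDl mul1r cosD sinD.
  split.
    rewrite !mulrDr opprD addrACA IH1; ring.
  rewrite !mulrDr addrACA IH2; ring.
have h1 := one_sub_cos_ge _ t1.
have h2 : ((cos t - 1) * C - sin t * S) ^+ 2 + ((cos t - 1) * S + sin t * C) ^+ 2 =
   2 * (1 - cos t) * (C ^+ 2 + S ^+ 2).
  have -> : 2 * (1 - cos t) = (cos t - 1) ^+ 2 + sin t ^+ 2.
    have := cos2Dsin2 t; nra.
  by ring.
rewrite E1 E2 in h2.
have h3 : (cos (N%:R * t) - 1) ^+ 2 + sin (N%:R * t) ^+ 2 <= 4.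
  have := cos2Dsin2 (N%:R * t); have := cos_geN1 (N%:R * t); nra.
have : 0 <= C ^+ 2 + S ^+ 2 by rewrite addr_ge0 ?sqr_ge0.
nra.
Qed.

Lemma distn_sum_le (N : nat) (g : nat -> R) : (forall m, 0 <= g m) ->
  \sum_(l < N) \sum_(l' < N) g `|l - l'|%N <= 2 * N%:R * \sum_(m < N) g m.
Proof.
move=> g0; rewrite -mulrA mulrCA.
have -> : N%:R * (2 * \sum_(m < N) g m) = \sum_(l < N) (2 * \sum_(m < N) g m).
  by rewrite sumr_const card_ord mulr_natl.
apply: ler_sum => l _.
rewrite (bigID (fun l' : 'I_N => (l' <= l)%N)) /= (_ : 2 = 1 + 1)// mulrDl mul1r.
have aux (P : pred 'I_N) (h : 'I_N -> 'I_N) : {in P &, injective h} ->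
   (forall i, P i -> `|l - i|%N = h i) ->
   \sum_(l' < N | P l') g `|l - l'|%N <= \sum_(m < N) g m.
  move=> hi hE; rewrite (eq_bigr (fun i => g (h i))); last by move=> i /hE ->.
  rewrite -(big_imset (fun i : 'I_N => g i) hi) /=.
  rewrite [leLHS]big_mkcond; apply: ler_sum => i _; by case: ifP.
have N0 : (0 < N)%N by exact: leq_ltn_trans (ltn_ord l).
have ib (i : 'I_N) : (`|l - i| < N)%N by have := ltn_ord i; have := ltn_ord l; lia.
apply: lerD; apply: (aux _ (fun i => Ordinal (ib i))) => // i j; rewrite !unfold_in => h1 h2 [] h3;
  apply: val_inj => /=; lia.
Qed.

Lemma distn_sum_ge (M : nat) (g : nat -> R) : (forall m, 0 <= g m) ->
  M%:R * \sum_(m < M) g m <= \sum_(l < 2 * M) \sum_(l' < 2 * M) g `|l - l'|%N.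
Proof.
move=> g0; rewrite (_ : M%:R * _ = \sum_(l < M) \sum_(m < M) g m); last first.
  by rewrite sumr_const card_ord mulr_natl.
have bl (l : 'I_M) : (M + l < 2 * M)%N by have := ltn_ord l; lia.
have bm (l m : 'I_M) : (M + l - m < 2 * M)%N by have := ltn_ord l; lia.
have sub (T : finType) (h : 'I_M -> T) (F : T -> R) : injective h -> (forall t, 0 <= F t) ->
   \sum_(l < M) F (h l) <= \sum_t F t.
  move=> hi F0.
  have -> : \sum_(l < M) F (h l) = \sum_(l in [set: 'I_M]%SET) F (h l).
    by apply: eq_bigl => x; rewrite inE.
  rewrite -(big_imset F (h := h)) /=; last by move=> x y _ _; exact: hi.
  rewrite [leLHS]big_mkcond; apply: ler_sum => i _; by case: ifP.
apply: le_trans (sub _ (fun l => Ordinal (bl l)) (fun l => \sum_(l' < 2 * M) g `|l - l'|%N) _ _).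
- apply: ler_sum => l _.
  apply: le_trans (sub _ (fun m => Ordinal (bm l m)) (fun l' => g `|Ordinal (bl l) - l'|%N) _ _) => //.
    apply: ler_sum => m _ /=; rewrite (_ : `|M + l - (M + l - m)|%N = m)//.
    have := ltn_ord m; lia.
  by move=> m m' [] h; apply: val_inj => /=; have := ltn_ord m; have := ltn_ord m'; lia.
- by move=> m m' [] h; apply: val_inj => /=; lia.
- by move=> l; apply: sumr_ge0.
Qed.

Lemma expsum2_dist (I : finType) (p f : I -> R) (l l' : nat) :
  expsum2 p (fun i => (l%:R - l'%:R) * f i) = expsum2 p (fun i => `|l - l'|%N%:R * f i).
Proof.
have [ll|ll] := leqP l' l.
  by apply: eq_expsum2 => i; rewrite -natrB// (_ : `|l - l'|%N = (l - l')%N)//; lia.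
rewrite -expsum2_opp; apply: eq_expsum2 => i; rewrite -mulNr opprB -natrB; last exact: ltnW.
by rewrite (_ : `|l - l'|%N = (l' - l)%N)//; lia.
Qed.

(** A sum of collisions measured by the Dirichlet kernel is a sum of squared
    exponential sums over differences of frequencies, so that both upper and lower
    bounds on differences can be applied to it. *)
Lemma sum_dirichlet2 (I : finType) (p f : I -> R) N :
  \sum_i \sum_j p i * p j * dirichlet2 N (f i - f j) =
  \sum_(l < N) \sum_(l' < N) expsum2 p (fun i => `|l - l'|%N%:R * f i).
Proof.
transitivity (\sum_i \sum_j \sum_(l < N) \sum_(l' < N)
    p i * p j * cos ((l%:R - l'%:R) * (f i - f j))).
  apply: eq_bigr => i _; apply: eq_bigr => j _; rewrite dirichlet2_pair mulr_sumr.
  by apply: eq_bigr => l _; rewrite mulr_sumr.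
transitivity (\sum_i \sum_(l < N) \sum_j \sum_(l' < N)
    p i * p j * cos ((l%:R - l'%:R) * (f i - f j))).
  by apply: eq_bigr => i _; rewrite exchange_big.
rewrite exchange_big /=; apply: eq_bigr => l _.
transitivity (\sum_i \sum_(l' < N) \sum_j
    p i * p j * cos ((l%:R - l'%:R) * (f i - f j))).
  by apply: eq_bigr => i _; rewrite exchange_big.
rewrite exchange_big /=; apply: eq_bigr => l' _.
rewrite -expsum2_dist expsum2_pair; apply: eq_bigr => i _; apply: eq_bigr => j _.
by congr (_ * cos _); ring.
Qed.

(** The squared Dirichlet kernel is nonnegative everywhere, and at least
    N^2 / 4 on collisions; hence the number of collisions is controlled by the
    frequencies below N. *)
Lemma collision_le (I : finType) (p f : I -> R) (N : nat) : (0 < N)%N ->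
  (forall i, 0 <= p i) ->
  \sum_i \sum_(j | `|N%:R * (f i - f j)| <= 1) p i * p j <=
  8 / N%:R * \sum_(m < N) expsum2 p (fun i => m%:R * f i).
Proof.
move=> N0 p0; have NR : 0 < N%:R :> R by rewrite ltr0n.
have := distn_sum_le N (fun m => expsum2 p (fun i => m%:R * f i)) (fun m => expsum2_ge0 _ _ _).
rewrite -sum_dirichlet2 => h.
have -> : 8 / N%:R * \sum_(m < N) expsum2 p (fun i => m%:R * f i) =
  4 / N%:R ^+ 2 * (2 * N%:R * \sum_(m < N) expsum2 p (fun i => m%:R * f i)).
  by field; rewrite gt_eqF.
apply: le_trans (ler_wpM2l _ h); last by rewrite divr_ge0 ?exprn_ge0.
rewrite mulr_sumr; apply: ler_sum => i _.
rewrite mulr_sumr [leLHS]big_mkcond; apply: ler_sum => j _.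
have pp : 0 <= p i * p j by rewrite mulr_ge0.
have r0 : 0 <= 4 / N%:R ^+ 2 * (p i * p j * dirichlet2 N (f i - f j)).
  by rewrite !mulr_ge0 ?dirichlet2_ge0 ?invr_ge0 ?exprn_ge0.
case: ifP => [/dirichlet2_small d|//].
rewrite mulrCA ler_peMr// -ler_pdivrMl; last by rewrite divr_gt0 ?exprn_gt0.
by rewrite mulr1 invf_div.
Qed.

End energy.

(** * Exponential sums of Frostman weights *)

Section frostman_weight.
Context {R : realType}.
Variable rho : R.
Hypothesis rho_gt : 1 / 2 < rho.
Hypothesis rho_le1 : rho <= 1.
Variable n : nat.
Implicit Types p : nat -> R.

Let rho0 : 0 < rho. Proof. by apply: lt_trans rho_gt; rewrite divr_gt0. Qed.

(** Discrete analogue, at scale 2^-n, of a measure giving mass at most rho^k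
    to the dyadic intervals of length 2^-k. *)
Definition frostman_weight p := (forall i, 0 <= p i) /\
  forall k j, (k <= n)%N ->
     \sum_(i < 2 ^ n | (i %/ 2 ^ (n - k))%N == j) p i <= rho ^+ k.

Definition gridpt (i : nat) : R := i%:R / 2 ^+ n.

Lemma frostman_weight_total p : frostman_weight p -> \sum_(i < 2 ^ n) p i <= 1.
Proof.
move=> [p0 pF]; have := pF 0%N 0%N (leq0n n); rewrite expr0 subn0.
rewrite (eq_bigl predT)// => i; rewrite divn_small ?eqxx//; exact: ltn_ord.
Qed.

Lemma frostman_weight_sub p p' : frostman_weight p -> (forall i, 0 <= p' i <= p i) -> frostman_weight p'.
Proof.
move=> [p0 pF] h; split=> [i|k j kn]; first by have /andP[] := h i.
by apply: le_trans (pF k j kn); apply: ler_sum => i _; have /andP[] := h i.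
Qed.

(** Points at distance at most A / 2^k lie in dyadic intervals of generation k
    whose indices differ by at most A. *)
Lemma frostman_weight_ball p k A i0 : frostman_weight p -> (k <= n)%N ->
  \sum_(i < 2 ^ n | (i <= i0 + A * 2 ^ (n - k))%N && (i0 <= i + A * 2 ^ (n - k))%N) p i
  <= (2 * A + 1)%:R * rho ^+ k.
Proof.
move=> [p0 pF] kn; set d := (2 ^ (n - k))%N.
have d0 : (0 < d)%N by rewrite expn_gt0.
have -> : (2 * A + 1)%:R * rho ^+ k = \sum_(e < 2 * A + 1) rho ^+ k.
  by rewrite sumr_const card_ord mulr_natl.
apply: (@le_trans _ _ (\sum_(e < 2 * A + 1) \sum_(i < 2 ^ n | (i %/ d + A == i0 %/ d + e)%N) p i)).
  under [leRHS]eq_bigr do rewrite big_mkcond.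
  rewrite exchange_big [leLHS]big_mkcond; apply: ler_sum => i _.
  have s0 (e : 'I_(2 * A + 1)) : 0 <= (if (i %/ d + A == i0 %/ d + e)%N then p i else 0).
    by case: ifP.
  case: ifP => [/andP[h1 h2]|_]; last by apply: sumr_ge0.
  have e1 : (i %/ d <= i0 %/ d + A)%N.
    by rewrite addnC -divnMDl// addnC mulnC leq_div2r// mulnC.
  have e2 : (i0 %/ d <= i %/ d + A)%N.
    by rewrite addnC -divnMDl// addnC mulnC leq_div2r// mulnC.
  have eb : (i %/ d + A - i0 %/ d < 2 * A + 1)%N by lia.
  rewrite (bigD1 (Ordinal eb))//= (_ : (_ == _)%N = true); last by apply/eqP; lia.
  by rewrite lerDl sumr_ge0.
apply: ler_sum => e _.
have [Ae|eA] := leqP A (i0 %/ d + e)%N.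
  apply: le_trans (pF k (i0 %/ d + e - A)%N kn); rewrite -/d.
  rewrite le_eqVlt; apply/orP; left; apply/eqP; apply: eq_bigl => i.
  by rewrite -/d; apply/eqP/eqP; move: (i %/ d)%N (i0 %/ d)%N Ae => a b; lia.
rewrite big1; first by rewrite exprn_ge0// ltW.
by move=> i /eqP; move: (i %/ d)%N (i0 %/ d)%N eA => a b; lia.
Qed.

Lemma gridpt_dist i j A k : (k <= n)%N -> `|gridpt i - gridpt j| <= A%:R / 2 ^+ k ->
  (i <= j + A * 2 ^ (n - k))%N && (j <= i + A * 2 ^ (n - k))%N.
Proof.
move=> kn; rewrite /gridpt -mulrBl normrM [X in _ * X <= _]ger0_norm ?invr_ge0 ?exprn_ge0//.
have E : A%:R / 2 ^+ k * 2 ^+ n = (A * 2 ^ (n - k))%:R :> R.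
  rewrite natrM natrX mulrAC -mulrA; congr (_ * _).
  by rewrite -{1}(subnK kn) exprD mulfK// expf_neq0.
rewrite ler_pdivrMr ?exprn_gt0// E ler_norml => /andP[h1 h2].
rewrite -!(ler_nat R) !natrD; apply/andP; split; lra.
Qed.

Lemma gridpt_diff_le1 (i j : 'I_(2 ^ n)) : `|gridpt i - gridpt j| <= 1.
Proof.
have b (i' : 'I_(2 ^ n)) : 0 <= gridpt i' <= 1.
  rewrite /gridpt divr_ge0 ?exprn_ge0//= ler_pdivrMr ?exprn_gt0// mul1r -natrX ler_nat.
  exact/ltnW/ltn_ord.
have := b i; have := b j; rewrite ler_norml; lra.
Qed.

(** For |t| about 2^-a the kernel is at most a multiple of 4^a by
    [dirichlet2_decay]; for |t| below 2^-K the trivial bound 4^K is used. *)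
Lemma dirichlet2_dyadic K t : `|t| <= 1 ->
  dirichlet2 (2 ^ K) t <= \sum_(a < K.+1) (if `|t| <= 1 / 2 ^+ a then 32 * 4 ^+ a else 0 : R).
Proof.
move=> t1.
have s0 (a : 'I_K.+1) : 0 <= (if `|t| <= 1 / 2 ^+ a then 32 * 4 ^+ a else 0 : R).
  by case: ifP => // _; rewrite mulr_ge0 ?exprn_ge0.
have [tK|Kt] := leP `|t| (1 / 2 ^+ K).
  rewrite (bigD1 ord_max)//= tK ler_wpDr ?sumr_ge0//.
  apply: le_trans (dirichlet2_le _ _) _; rewrite natrX -exprM mulnC exprM.
  by rewrite (_ : 2 ^+ 2 = 4)// -?natrX// ler_peMl ?exprn_ge0// ler1n.
have [a aK /andP[a1 a2]] : exists2 a, (a < K)%N & (`|t| <= 1 / 2 ^+ a) && (1 / 2 ^+ a.+1 < `|t|).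
  elim: K Kt {s0} => [|K IH] Kt; first by move: Kt; rewrite expr0 divr1 ltNge t1.
  have [tK|/IH[a aK h]] := leP `|t| (1 / 2 ^+ K); first by exists K => //; rewrite tK.
  by exists a => //; exact: ltnW.
have aK' : (a < K.+1)%N by exact: ltnW.
rewrite (bigD1 (Ordinal aK'))//= a1 ler_wpDr ?sumr_ge0//.
have d := dirichlet2_decay (2 ^ K) _ t1.
have h4 : (1 / 2 ^+ a.+1) ^+ 2 < t ^+ 2.
  by rewrite -[ltRHS]real_normK ?num_real// ltr_pXn2r ?nnegrE// divr_ge0 ?exprn_ge0.
have t20 : 0 < t ^+ 2 by apply: le_lt_trans h4; exact: sqr_ge0.
have E : (1 / 2 ^+ a.+1) ^+ 2 * (4 * 4 ^+ a) = 1 :> R.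
  rewrite -exprS expr_div_n expr1n -exprM mulnC exprM (_ : 2 ^+ 2 = 4) -?natrX//.
  by rewrite mul1r mulVf// expf_neq0.
have q0 : 0 < 4 ^+ a :> R by rewrite exprn_gt0.
rewrite -(ler_pM2r t20) (le_trans d)//; nra.
Qed.

Lemma geom_le (z : R) K : 2 <= z -> \sum_(a < K.+1) z ^+ a <= 2 * z ^+ K.
Proof.
move=> z2; elim: K => [|K IH]; first by rewrite big_ord1 expr0; lra.
rewrite big_ord_recr /= (le_trans (lerD IH (lexx _)))// exprS.
have : 0 <= z ^+ K by rewrite exprn_ge0//; lra.
nra.
Qed.

(** The annulus |t| about 2^-a contributes 4^a rho^a; as 4 rho > 2, the last
    generation K dominates the geometric sum. *)
Lemma frostman_weight_kernel p K : frostman_weight p -> (K <= n)%N ->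
  \sum_(i < 2 ^ n) \sum_(j < 2 ^ n) p i * p j * dirichlet2 (2 ^ K) (gridpt i - gridpt j)
  <= 192 * (4 * rho) ^+ K.
Proof.
move=> fp Kn; have [p0 pF] := fp.
have step (i : 'I_(2 ^ n)) : \sum_(j < 2 ^ n) p j * dirichlet2 (2 ^ K) (gridpt i - gridpt j) <= 192 * (4 * rho) ^+ K.
  apply: (@le_trans _ _ (\sum_(a < K.+1) 96 * (4 * rho) ^+ a)); last first.
    rewrite -mulr_sumr; have := geom_le (4 * rho) K; have := rho_gt; lra.
  apply: (@le_trans _ _ (\sum_(j < 2 ^ n) \sum_(a < K.+1)
      (if `|gridpt i - gridpt j| <= 1 / 2 ^+ a then 32 * 4 ^+ a * p j else 0))).
    apply: ler_sum => j _.
    apply: le_trans (ler_wpM2l (p0 j) (dirichlet2_dyadic K _ (gridpt_diff_le1 i j))) _.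
    rewrite mulr_sumr; apply: ler_sum => a _; case: ifP => _; last by rewrite mulr0.
    by rewrite mulrC.
  rewrite exchange_big /=; apply: ler_sum => a _.
  have an : (a <= n)%N by apply: leq_trans Kn; rewrite -ltnS; exact: ltn_ord.
  rewrite -big_mkcond /= -mulr_sumr exprMn.
  have -> : 96 * (4 ^+ a * rho ^+ a) = 32 * 4 ^+ a * (3 * rho ^+ a) by ring.
  rewrite ler_wpM2l ?mulr_ge0 ?exprn_ge0//.
  apply: le_trans (frostman_weight_ball p a 1 i fp an).
  rewrite [leLHS]big_mkcond [leRHS]big_mkcond; apply: ler_sum => j _.
  case: ifP => [h|_]; last by case: ifP.
  have := gridpt_dist j i 1 a an; rewrite distrC => /(_ h); by rewrite andbC => ->.
apply: (@le_trans _ _ (\sum_(i < 2 ^ n) p i * (192 * (4 * rho) ^+ K))).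
  apply: ler_sum => i _; under eq_bigr do rewrite -mulrA.
  by rewrite -mulr_sumr ler_wpM2l.
rewrite -mulr_suml; apply: ler_piMl; last exact: frostman_weight_total.
by apply: mulr_ge0; [exact: ler0n|rewrite exprn_ge0// mulr_ge0// ltW].
Qed.

(** Discrete form of the fact that the squared Fourier transform of a
    Frostman measure of exponent s has integral O(M^(1 - s)) over [-M, M].  Every
    frequency m < 2^(k+1) is a difference of frequencies below 2^(k+2) in at least
    2^(k+1) ways, so the sum is controlled by the kernel of order 2^(k+2). *)
Lemma frostman_weight_energy p k : frostman_weight p -> (k + 2 <= n)%N ->
  \sum_(m < 2 ^ k.+1) expsum2 (fun i : 'I_(2 ^ n) => p i) (fun i => m%:R * gridpt i)
  <= 1536 * (2 * rho) ^+ k.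
Proof.
move=> fp kn.
have := frostman_weight_kernel p k.+2 fp; rewrite addn2 in kn => /(_ kn).
rewrite sum_dirichlet2 => h.
have := distn_sum_ge (2 ^ k.+1) (fun m => expsum2 (fun i : 'I_(2 ^ n) => p i) (fun i => m%:R * gridpt i))
  (fun m => expsum2_ge0 _ _ _).
rewrite -expnS => /le_trans/(_ h).
have M0 : 0 < (2 ^ k.+1)%:R :> R by rewrite ltr0n expn_gt0.
rewrite -ler_pdivlMl// => /le_trans; apply.
rewrite natrX ler_pdivrMl ?exprn_gt0//.
rewrite (_ : 4 * rho = 2 * (2 * rho)); last by ring.
rewrite exprMn !exprS.
have : 0 <= (2 * rho) ^+ k by rewrite exprn_ge0// mulr_ge0// ltW.
have : 0 < 2 ^+ k :> R by rewrite exprn_gt0.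
set X := 2 ^+ k; set Y := (2 * rho) ^+ k => X0 Y0.
have XY : 0 <= X * Y by rewrite mulr_ge0// ltW.
have : rho ^+ 2 <= 1 by rewrite expr_le1// ltW.
move=> r2; have : X * Y * rho ^+ 2 <= X * Y by rewrite ler_piMr.
lra.
Qed.

(** The sum over j is a discrete Sobolev norm: it involves the tails of the
    weight p, which are again Frostman weights, and only the frequency tau. *)
Definition local_majorant p (tau : R) : R :=
  2 * (expsum2 (fun i : 'I_(2 ^ n) => p i) (fun i => tau * gridpt i) +
   1 / 2 ^+ n * \sum_(j < 2 ^ n)
     expsum2 (fun i : 'I_(2 ^ n) => if (j < i)%N then p i else 0) (fun i => tau * gridpt i)).

Lemma local_majorant_ge0 p t : 0 <= local_majorant p t.
Proof.
rewrite mulr_ge0// addr_ge0 ?expsum2_ge0// mulr_ge0 ?divr_ge0 ?exprn_ge0// sumr_ge0// => j _.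
exact: expsum2_ge0.
Qed.

Lemma local_majorantN p t : local_majorant p (- t) = local_majorant p t.
Proof.
have e q : expsum2 q (fun i : 'I_(2 ^ n) => - t * gridpt i) = expsum2 q (fun i : 'I_(2 ^ n) => t * gridpt i).
  by rewrite -expsum2_opp; apply: eq_expsum2 => i; rewrite mulNr opprK.
rewrite /local_majorant e; congr (_ * (_ + _ * _)); apply: eq_bigr => j _; exact: e.
Qed.

Lemma local_majorant_sum p k : frostman_weight p -> (k + 2 <= n)%N ->
  \sum_(m < 2 ^ k.+1) local_majorant p m%:R <= 6144 * (2 * rho) ^+ k.
Proof.
move=> fp kn.
rewrite -mulr_sumr big_split /= -mulr_sumr exchange_big /=.
have h1 := frostman_weight_energy p k fp kn.
have h2 : \sum_(j < 2 ^ n) \sum_(m < 2 ^ k.+1)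
   expsum2 (fun i : 'I_(2 ^ n) => if (j < i)%N then p i else 0) (fun i => m%:R * gridpt i)
   <= 2 ^+ n * (1536 * (2 * rho) ^+ k).
  have -> : 2 ^+ n * (1536 * (2 * rho) ^+ k) = \sum_(j < 2 ^ n) (1536 * (2 * rho) ^+ k).
    by rewrite sumr_const card_ord -[RHS]mulr_natl natrX.
  apply: ler_sum => j _; apply: (frostman_weight_energy (fun i => if (j < i)%N then p i else 0)) => //.
  apply: (frostman_weight_sub p) => // i; have [p0 _] := fp.
  by case: ifP; rewrite ?lexx ?p0.
have h3 : 1 / 2 ^+ n * \sum_(j < 2 ^ n) \sum_(m < 2 ^ k.+1)
   expsum2 (fun i : 'I_(2 ^ n) => if (j < i)%N then p i else 0) (fun i => m%:R * gridpt i)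
   <= 1536 * (2 * rho) ^+ k.
  by rewrite mul1r ler_pdivrMl ?exprn_gt0.
lra.
Qed.

(** The frequencies i - m with i <= 2 m are, up to sign, the
    natural numbers up to m, each taken at most twice. *)
Lemma local_majorant_sum_center p m k : frostman_weight p -> (2 ^ k <= m < 2 ^ k.+1)%N -> (k + 2 <= n)%N ->
  \sum_(i < 2 * m + 1) local_majorant p (i%:R - m%:R) <= 12288 * (2 * rho) ^+ k.
Proof.
move=> fp /andP[m1 m2] kn.
have h := local_majorant_sum p k fp kn.
have le (M : nat) : (M <= 2 ^ k.+1)%N -> \sum_(j < M) local_majorant p j%:R <= \sum_(j < 2 ^ k.+1) local_majorant p j%:R.
  move=> M2; rewrite (big_ord_widen _ (fun j => local_majorant p j%:R) M2) big_mkcond; apply: ler_sum => j _.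
  by case: ifP => // _; exact: local_majorant_ge0.
have -> : (2 * m + 1 = m + m.+1)%N by rewrite mul2n -addnn addn1 addnS.
rewrite big_split_ord /=.
have h1 := le m.+1 m2.
have h2 : \sum_(i < m) local_majorant p (i%:R - m%:R) <= \sum_(j < 2 ^ k.+1) local_majorant p j%:R.
  apply: le_trans (le m.+1 m2); rewrite big_ord_recl /= ler_wpDl ?local_majorant_ge0//.
  rewrite (reindex_inj rev_ord_inj) /=; apply: ler_sum => i _.
  rewrite -local_majorantN opprB natrB; last exact: ltn_ord.
  by rewrite opprB addrC subrK le_eqVlt; apply/orP; left.
have h3 : \sum_(i < m.+1) local_majorant p ((m + i)%:R - m%:R) = \sum_(i < m.+1) local_majorant p i%:R.
  by apply: eq_bigr => i _; rewrite natrD addrC addKr.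
by rewrite h3; lra.
Qed.

(** Summation by parts. *)
Lemma abel (a c : nat -> R) N :
  \sum_(i < N) a i * c i = c 0%N * \sum_(i < N) a i +
    \sum_(j < N) (c j.+1 - c j) * \sum_(i < N) (if (j < i)%N then a i else 0).
Proof.
under [X in _ = _ + X]eq_bigr do rewrite mulr_sumr.
rewrite exchange_big mulr_sumr -big_split /=; apply: eq_bigr => i _.
have -> : \sum_(j < N) (c j.+1 - c j) * (if (j < i)%N then a i else 0) = (c i - c 0%N) * a i.
  rewrite (eq_bigr (fun j : 'I_N => if (j < i)%N then (c j.+1 - c j) * a i else 0)); last first.
    by move=> j _; case: ifP => // _; rewrite mulr0.
  rewrite -big_mkcond /= -mulr_suml; congr (_ * _).
  rewrite -(big_ord_widen N (fun j => c j.+1 - c j) (ltnW (ltn_ord i))).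
  by rewrite -(big_mkord predT (fun j => c j.+1 - c j)) telescope_sumr.
ring.
Qed.

(** An exponential sum of weights on [0, 1) is essentially constant on unit
    intervals of frequencies.  Summation by parts moves the factor
    exp (sqrt (-1) * v * x) away from the sum, at the cost of the tails of the
    weight multiplied by increments of size at most 2^-n; Cauchy-Schwarz over the
    2^n increments gives the factor 1 / 2^n. *)
Lemma expsum2_local p tau v : 0 <= v <= 1 ->
  expsum2 (fun i : 'I_(2 ^ n) => p i) (fun i => (tau + v) * gridpt i) <= local_majorant p tau.
Proof.
move=> /andP[v0 v1].
pose al i := p i * cos (tau * gridpt i); pose be i := p i * sin (tau * gridpt i).
pose c i := cos (v * gridpt i); pose s i := sin (v * gridpt i).
have c00 : c 0%N = 1 by rewrite /c /gridpt mul0r mulr0 cos0.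
have s00 : s 0%N = 0 by rewrite /s /gridpt mul0r mulr0 sin0.
pose A := \sum_(i < 2 ^ n) al i; pose B := \sum_(i < 2 ^ n) be i.
pose AA (j : nat) := \sum_(i < 2 ^ n) (if (j < i)%N then al i else 0).
pose BB (j : nat) := \sum_(i < 2 ^ n) (if (j < i)%N then be i else 0).
pose X1 j := (c j.+1 - c j) * AA j - (s j.+1 - s j) * BB j.
pose Y1 j := (s j.+1 - s j) * AA j + (c j.+1 - c j) * BB j.
have E1 : \sum_(i < 2 ^ n) p i * cos ((tau + v) * gridpt i) = A + \sum_(j < 2 ^ n) X1 j.
  rewrite (eq_bigr (fun i : 'I_(2 ^ n) => al i * c i - be i * s i)); last first.
    by move=> i _; rewrite mulrDl cosD /al /be /c /s; ring.
  by rewrite sumrB (abel al c) (abel be s) c00 s00 mul1r mul0r add0r /X1 sumrB -/A addrA.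
have E2 : \sum_(i < 2 ^ n) p i * sin ((tau + v) * gridpt i) = B + \sum_(j < 2 ^ n) Y1 j.
  rewrite (eq_bigr (fun i : 'I_(2 ^ n) => al i * s i + be i * c i)); last first.
    by move=> i _; rewrite mulrDl sinD /al /be /c /s; ring.
  by rewrite big_split /= (abel al s) (abel be c) c00 s00 mul1r mul0r add0r /Y1 big_split /= -/B; ring.
have XY : (\sum_(j < 2 ^ n) X1 j) ^+ 2 + (\sum_(j < 2 ^ n) Y1 j) ^+ 2 <=
   1 / 2 ^+ n * \sum_(j < 2 ^ n) (AA j ^+ 2 + BB j ^+ 2).
  have h1 := sum_sqr_le _ (index_enum 'I_(2 ^ n)) (fun j : 'I_(2 ^ n) => X1 j).
  have h2 := sum_sqr_le _ (index_enum 'I_(2 ^ n)) (fun j : 'I_(2 ^ n) => Y1 j).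
  apply: le_trans (lerD h1 h2) _.
  have -> : (size (index_enum 'I_(2 ^ n)))%:R = 2 ^+ n :> R.
    by rewrite -sum1_size (eq_bigl (mem 'I_(2 ^ n)))// sum1_card card_ord natrX.
  rewrite -mulrDr -big_split /=.
  rewrite mul1r ler_pdivlMl ?exprn_gt0// mulrA -expr2 mulr_sumr; apply: ler_sum => j _.
  have -> : X1 j ^+ 2 + Y1 j ^+ 2 =
     ((c j.+1 - c j) ^+ 2 + (s j.+1 - s j) ^+ 2) * (AA j ^+ 2 + BB j ^+ 2).
    by rewrite /X1 /Y1; ring.
  rewrite mulrA ler_piMl ?addr_ge0 ?sqr_ge0//.
  apply: le_trans (ler_wpM2l _ (chord_sq _ _)) _; first by rewrite exprn_ge0// exprn_ge0.
  have -> : v * gridpt j.+1 - v * gridpt j = v / 2 ^+ n.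
    by rewrite -mulrBr /gridpt -mulrBl -[j.+1%:R]natr1 [_ + 1]addrC addrK mul1r.
  by rewrite -exprMn mulrCA divff ?expf_neq0// mulr1 expr_le1.
rewrite /expsum2 E1 E2 /local_majorant.
have EA : expsum2 (fun i : 'I_(2 ^ n) => p i) (fun i => tau * gridpt i) = A ^+ 2 + B ^+ 2 by [].
have EJ (j : 'I_(2 ^ n)) : expsum2 (fun i : 'I_(2 ^ n) => if (j < i)%N then p i else 0)
   (fun i => tau * gridpt i) = AA j ^+ 2 + BB j ^+ 2.
  rewrite /expsum2 /AA /BB; congr (_ ^+ 2 + _ ^+ 2); apply: eq_bigr => i _;
  by case: ifP => // _; rewrite mul0r.
rewrite EA (eq_bigr _ (fun j _ => EJ j)).
set X := \sum_(j < 2 ^ n) X1 j in XY *; set Y := \sum_(j < 2 ^ n) Y1 j in XY *.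
set Z := 1 / 2 ^+ n * _ in XY *.
have := sqr_ge0 (A - X); have := sqr_ge0 (B - Y); nra.
Qed.

End frostman_weight.

(** * Averaging over a family of linear forms *)

Lemma sum_uniq_eq {R : realType} (T : eqType) (s : seq T) (x : T) (F : T -> R) :
  x \in s -> uniq s -> \sum_(k <- s | x == k) F k = F x.
Proof.
move=> xs us; rewrite big_mkcond (bigD1_seq x)//= eqxx big1 ?addr0// => k kx.
by rewrite eq_sym (negbTE kx).
Qed.

(** A weight carried by few cells has many pairs of points in a common cell. *)
Lemma cells_cauchy_schwarz {R : realType} (I : finType) (P : I -> R) (c : I -> nat)
  (r : rel I) (J : seq nat) : (forall i, 0 <= P i) ->
  (forall i, P i != 0 -> c i \in J) -> (forall i j, c i = c j -> r i j) ->
  (\sum_i P i) ^+ 2 <= (size J)%:R * \sum_i \sum_(j | r i j) P i * P j.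
Proof.
move=> P0 cJ cr.
have -> : \sum_i P i = \sum_(k <- undup J) \sum_(i | c i == k) P i.
  under [RHS]eq_bigr do rewrite big_mkcond.
  rewrite exchange_big /=; apply: eq_bigr => i _; rewrite -big_mkcond /=.
  have [->|Pi] := eqVneq (P i) 0; first by rewrite big1.
  by rewrite sum_uniq_eq ?undup_uniq// mem_undup cJ.
apply: le_trans (sum_sqr_le _ _ _) _.
apply: ler_pM => //; rewrite ?sumr_ge0//; first by move=> k _; exact: sqr_ge0.
  by rewrite ler_nat size_undup.
apply: (@le_trans _ _ (\sum_(k <- undup J) \sum_i \sum_(j | r i j)
    (if c i == k then P i * P j else 0))).
  apply: ler_sum => k _; rewrite expr2 big_distrlr /= big_mkcond; apply: ler_sum => i _.
  case: ifP => [/eqP ci|_]; last by apply: sumr_ge0 => j _.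
  rewrite big_mkcond [leRHS]big_mkcond; apply: ler_sum => j _.
  have Pij : 0 <= P i * P j by rewrite mulr_ge0.
  by case: ifP => [/eqP cj|_]; [rewrite cr// ci cj|case: ifP].
rewrite exchange_big /=; apply: ler_sum => i _.
rewrite exchange_big /=; apply: ler_sum => j _.
have Pij : 0 <= P i * P j by rewrite mulr_ge0.
rewrite -big_mkcond /=.
have [kJ|kJ] := boolP (c i \in undup J).
  by rewrite (sum_uniq_eq _ (undup J) (c i) (fun=> P i * P j)) ?undup_uniq.
by rewrite big_seq_cond big1// => k /andP[kJ' /eqP e]; rewrite e kJ' in kJ.
Qed.

Section discrete.
Context {R : realType}.
Variable rho : R.
Hypothesis rho_gt : 1 / 2 < rho.
Hypothesis rho_le1 : rho <= 1.
Hypothesis rho6 : 16 * rho ^+ 6 < 1.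
Variable n : nat.
Variable p : nat -> R.
Hypothesis fp : frostman_weight rho n p.
Variables (I : finType) (W : I -> R) (u1 u2 u3 : I -> R) (H : R).
Hypothesis W0 : forall y, 0 <= W y.
Hypothesis W1 : \sum_y W y <= 1.
Hypothesis H0 : 0 <= H.
Hypothesis u1b : forall y, `|u1 y| <= 1.
Hypothesis u2b : forall y, `|u2 y| <= 1.
Hypothesis u3b : forall y, `|u3 y| <= 1.
Hypothesis mass : forall k y0, (k <= n)%N -> W y0 != 0 ->
  \sum_(y | [&& `|u1 y - u1 y0| <= 1 / 2 ^+ k, `|u2 y - u2 y0| <= 1 / 2 ^+ k &
     `|u3 y - u3 y0| <= 1 / 2 ^+ k]) W y <= H * rho ^+ (3 * k).

Let rho0 : 0 < rho. Proof. by apply: lt_trans rho_gt; rewrite divr_gt0. Qed.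

Variable C : R.
Hypothesis C0 : 0 <= C.
Hypothesis Csum : forall m k, (2 ^ k <= m < 2 ^ k.+1)%N -> (k + 2 <= n)%N ->
  \sum_(i < 2 * m + 1) local_majorant n p (i%:R - m%:R) <= C * (2 * rho) ^+ k.

Let E (t : R) : R := expsum2 (fun i : 'I_(2 ^ n) => p i) (fun i => t * gridpt n i).

Let p0 i : 0 <= p i. Proof. by case: fp. Qed.

Let cell (m : nat) (x : R) : nat := Num.truncn (m%:R * (x + 1)).

Lemma cell_itv m x : `|x| <= 1 ->
  ((cell m x)%:R <= m%:R * x + m%:R < (cell m x)%:R + 1) /\ (cell m x < 2 * m + 1)%N.
Proof.
move=> x1; have x0 : 0 <= m%:R * (x + 1).
  by rewrite mulr_ge0//; move: x1; rewrite ler_norml; lra.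
have := truncn_itv x0; rewrite -/(cell m x) -[_.+1%:R]natr1 mulrDr mulr1 => h.
split=> //; rewrite addn1 ltnS -(ler_nat R); case/andP: h => h _; apply: le_trans h _.
rewrite natrM; have : 0 <= m%:R :> R by []; move: x1; rewrite ler_norml; nra.
Qed.

Lemma E_le m x : `|x| <= 1 -> E (m%:R * x) <= local_majorant n p ((cell m x)%:R - m%:R).
Proof.
move=> x1; have [/andP[a b] _] := cell_itv m x x1.
have -> : m%:R * x = ((cell m x)%:R - m%:R) + (m%:R * x + m%:R - (cell m x)%:R) by ring.
by apply: expsum2_local; lra.
Qed.

Lemma cell_close m k x x0 : (2 ^ k <= m)%N -> `|x| <= 1 -> `|x0| <= 1 ->
  cell m x = cell m x0 -> `|x - x0| <= 1 / 2 ^+ k.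
Proof.
move=> km x1 x01 e; have [/andP[a b] _] := cell_itv m x x1.
have [/andP[a0 b0] _] := cell_itv m x0 x01; rewrite e in a b.
have k0 : 0 < 2 ^+ k :> R by rewrite exprn_gt0.
have mk : 2 ^+ k <= m%:R :> R by rewrite -natrX ler_nat.
have h : `|(x - x0) * m%:R| <= 1 by rewrite ler_norml; lra.
rewrite ler_pdivlMr//; apply: le_trans h; rewrite normrM normr_nat.
by rewrite ler_wpM2l.
Qed.

(** Each frequency m u_i is replaced by the integer end of its cell, through
    [expsum2_local].  A triple of cells carries weight at most H rho^(3 k) by
    [mass], and the sum over triples factors into a cube. *)
Lemma block_bound m k : (2 ^ k <= m < 2 ^ k.+1)%N -> (k + 2 <= n)%N ->
  \sum_y W y * (E (m%:R * u1 y) * E (m%:R * u2 y) * E (m%:R * u3 y)) <=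
  H * C ^+ 3 * (8 * rho ^+ 6) ^+ k.
Proof.
move=> mk kn; have /andP[m1 m2] := mk.
have E0 t : 0 <= E t by exact: expsum2_ge0.
pose g (i : 'I_(2 * m + 1)) : R := local_majorant n p (i%:R - m%:R).
have g0 i : 0 <= g i by exact: local_majorant_ge0.
have ggg j1 j2 j3 : 0 <= g j1 * g j2 * g j3.
  by apply: mulr_ge0; [apply: mulr_ge0|]; exact: g0.
pose ka y : 'I_(2 * m + 1) * 'I_(2 * m + 1) * 'I_(2 * m + 1) :=
  (Ordinal (cell_itv m _ (u1b y)).2, Ordinal (cell_itv m _ (u2b y)).2,
   Ordinal (cell_itv m _ (u3b y)).2).
apply: (@le_trans _ _ (\sum_y W y * (g (ka y).1.1 * g (ka y).1.2 * g (ka y).2))).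
  apply: ler_sum => y _; apply: ler_wpM2l; first exact: W0.
  have e1 := E_le m _ (u1b y); have e2 := E_le m _ (u2b y).
  have e3 := E_le m _ (u3b y).
  apply: ler_pM; [apply: mulr_ge0; exact: E0|exact: E0| |exact: e3].
  by apply: ler_pM; [exact: E0|exact: E0|exact: e1|exact: e2].
rewrite (partition_big ka predT)//=.
apply: (@le_trans _ _ (\sum_(j : 'I_(2 * m + 1) * 'I_(2 * m + 1) * 'I_(2 * m + 1))
    g j.1.1 * g j.1.2 * g j.2 * (H * rho ^+ (3 * k)))).
  apply: ler_sum => j _.
  rewrite (eq_bigr (fun y => g j.1.1 * g j.1.2 * g j.2 * W y)); last first.
    by move=> y /eqP <-; rewrite mulrC.
  rewrite -mulr_sumr ler_wpM2l ?ggg//.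
  have [[y0 yj Wy0]|nW] := pselect (exists2 y0, ka y0 == j & W y0 != 0); last first.
    have Hr : 0 <= H * rho ^+ (3 * k).
      by rewrite mulr_ge0// exprn_ge0// ltW.
    rewrite big1.
      exact: Hr.
    move=> y yj; apply/eqP; apply: contrapT => Wy.
    by apply: nW; exists y => //; apply/negP.
  have kn' : (k <= n)%N by apply: leq_trans kn; rewrite leq_addr.
  apply: le_trans (mass k y0 kn' Wy0).
  rewrite big_mkcond [leRHS]big_mkcond; apply: ler_sum => y _.
  case: ifP => [yj'|_]; last by case: ifP.
  move: yj'; rewrite -(eqP yj) => /eqP[e1 e2 e3].
  by rewrite !(cell_close m k).
rewrite -mulr_suml.
have -> : \sum_(j : 'I_(2 * m + 1) * 'I_(2 * m + 1) * 'I_(2 * m + 1))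
    g j.1.1 * g j.1.2 * g j.2 = (\sum_i g i) ^+ 3.
  rewrite -(pair_bigA _ (fun x j => g x.1 * g x.2 * g j)) /=.
  rewrite -(pair_bigA _ (fun i j => \sum_l g i * g j * g l)) /=.
  rewrite exprSr expr2 !big_distrl /=; apply: eq_bigr => i _.
  rewrite -mulrA big_distrlr /= mulr_sumr; apply: eq_bigr => j _.
  by rewrite mulr_sumr; apply: eq_bigr => l _; rewrite mulrA.
have h := Csum m k mk kn; rewrite -/g in h.
have s0 : 0 <= \sum_i g i by rewrite sumr_ge0.
have h3 : (\sum_i g i) ^+ 3 <= (C * (2 * rho) ^+ k) ^+ 3.
  by rewrite ler_pXn2r ?nnegrE// (le_trans s0).
have Hr : 0 <= H * rho ^+ (3 * k) by apply: mulr_ge0 => //; rewrite exprn_ge0// ltW.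
apply: le_trans (ler_wpM2r Hr h3) _.
rewrite le_eqVlt; apply/orP; left; apply/eqP.
have -> : 8 * rho ^+ 6 = (2 * rho) ^+ 3 * rho ^+ 3 by ring.
rewrite [(C * _) ^+ 3]exprMn [(_ * rho ^+ 3) ^+ k]exprMn -!exprM (mulnC k 3).
ring.
Qed.

(** The 2^k frequencies between 2^k and 2^(k+1) contribute a multiple of
    2^k (8 rho^6)^k, a geometric series of ratio 16 rho^6. *)
Lemma freq_sum K : (K + 2 <= n)%N ->
  \sum_(m < 2 ^ K) \sum_y W y * (E (m%:R * u1 y) * E (m%:R * u2 y) * E (m%:R * u3 y))
  <= 1 + H * C ^+ 3 / (1 - 16 * rho ^+ 6).
Proof.
set T := fun m : nat => \sum_y W y * (E (m%:R * u1 y) * E (m%:R * u2 y) * E (m%:R * u3 y)).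
set B := H * _; set z := 16 * _ => Kn.
have B0 : 0 <= B by rewrite mulr_ge0 ?exprn_ge0.
have z0 : 0 <= z by rewrite mulr_ge0 ?exprn_ge0 ?ltW.
have z1 : 0 < 1 - z by rewrite subr_gt0.
suff : \sum_(m < 2 ^ K) T m <= 1 + B * ((1 - z ^+ K) / (1 - z)).
  move=> /le_trans; apply; rewrite lerD2l ler_wpM2l// ler_piMl ?invr_ge0 ?(ltW z1)//.
  by rewrite gerBl exprn_ge0.
elim: K Kn => [|K IH] Kn.
  rewrite big_ord1 expr0 subrr mul0r mulr0 addr0.
  have E1 : E (0%:R * 0) <= 1.
    apply: le_trans (expsum2_le _ _ _ _) _ => //.
    by rewrite expr_le1 ?sumr_ge0// (frostman_weight_total rho n p fp).
  have {}E1 x : E (0%:R * x) <= 1 by rewrite mul0r -(mul0r (0 : R)).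
  apply: le_trans W1; apply: ler_sum => y _; rewrite ler_piMr//.
  by rewrite !mulr_ile1 ?mulr_ge0 ?expsum2_ge0.
rewrite expnS mul2n -addnn big_split_ord /=.
have Kn' : (K + 2 <= n)%N by apply: leq_trans Kn; rewrite leq_add2r.
have {}IH := IH Kn'.
have h : \sum_(i < 2 ^ K) T (2 ^ K + i)%N <= B * z ^+ K.
  apply: (@le_trans _ _ (\sum_(i < 2 ^ K) B * (8 * rho ^+ 6) ^+ K)).
    apply: ler_sum => i _; apply: block_bound => //.
    by rewrite leq_addr /= expnS mul2n -addnn ltn_add2l.
  rewrite sumr_const card_ord -[_ *+ (2 ^ K)]mulr_natl natrX mulrCA -exprMn.
  by rewrite (_ : 2 * (8 * rho ^+ 6) = z)// /z; ring.
apply: le_trans (lerD IH h) _; rewrite -addrA lerD2l -mulrDr.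
rewrite le_eqVlt; apply/orP; left; apply/eqP; congr (_ * _).
by rewrite exprS; field; rewrite gt_eqF.
Qed.

Let phase (y : I) (a : 'I_(2 ^ n) * 'I_(2 ^ n) * 'I_(2 ^ n)) : R :=
  gridpt n a.1.1 * u1 y + gridpt n a.1.2 * u2 y + gridpt n a.2 * u3 y.

Lemma phase_bound y a : `|phase y a| <= 3.
Proof.
have b (i : 'I_(2 ^ n)) : 0 <= (gridpt n i : R) <= 1.
  rewrite /gridpt divr_ge0 ?exprn_ge0//= ler_pdivrMr ?exprn_gt0// mul1r -natrX ler_nat.
  exact/ltnW/ltn_ord.
have key (i : 'I_(2 ^ n)) (x : R) : `|x| <= 1 -> `|gridpt n i * x| <= 1.
  move=> x1; have /andP[g0 g1] := b i.
  by rewrite normrM mulr_ile1// ger0_norm.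
rewrite /phase (_ : 3 = 1 + 1 + 1); last by ring.
apply: le_trans (ler_normD _ _) _; rewrite lerD ?key//.
by apply: le_trans (ler_normD _ _) _; rewrite lerD ?key.
Qed.

(** For each fixed y, the values [phase y a] fall into few cells only if they
    collide often, by [cells_cauchy_schwarz]; on average over y there are few
    collisions, by [collision_le] and [freq_sum]. *)
Theorem discrete_main (J : seq nat) : (2 <= n)%N ->
  (forall (a : 'I_(2 ^ n) * 'I_(2 ^ n) * 'I_(2 ^ n)) y, p a.1.1 != 0 -> p a.1.2 != 0 -> p a.2 != 0 -> W y != 0 ->
     Num.truncn (2 ^+ (n - 2) * (phase y a + 3)) \in J) ->
  (\sum_(i < 2 ^ n) p i) ^+ 6 * \sum_y W y <=
  (size J)%:R * (8 / 2 ^+ (n - 2)) * (1 + H * C ^+ 3 / (1 - 16 * rho ^+ 6)).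
Proof.
move=> n2 hJ; set N := (2 ^ (n - 2))%N.
have N0 : (0 < N)%N by rewrite expn_gt0.
have NE : 2 ^+ (n - 2) = N%:R :> R by rewrite natrX.
rewrite NE in hJ *.
pose P (a : 'I_(2 ^ n) * 'I_(2 ^ n) * 'I_(2 ^ n)) := p a.1.1 * p a.1.2 * p a.2.
have P0 a : 0 <= P a by rewrite !mulr_ge0.
have PE : \sum_a P a = (\sum_(i < 2 ^ n) p i) ^+ 3.
  rewrite /P -(pair_bigA _ (fun (x : 'I_(2 ^ n) * 'I_(2 ^ n)) (j : 'I_(2 ^ n)) =>
    p x.1 * p x.2 * p j)) /=.
  rewrite -(pair_bigA _ (fun i j : 'I_(2 ^ n) => \sum_(l < 2 ^ n) p i * p j * p l)) /=.
  rewrite exprSr expr2 !big_distrl /=; apply: eq_bigr => i _.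
  rewrite -mulrA big_distrlr /= mulr_sumr; apply: eq_bigr => j _.
  by rewrite mulr_sumr; apply: eq_bigr => l _; rewrite mulrA.
have enE y (m : nat) : expsum2 P (fun a => m%:R * phase y a) =
    E (m%:R * u1 y) * E (m%:R * u2 y) * E (m%:R * u3 y).
  rewrite /E -expsum2_prod -expsum2_prod; apply: eq_expsum2 => a; rewrite /phase; ring.
have one y : W y != 0 -> (\sum_(i < 2 ^ n) p i) ^+ 6 <= (size J)%:R * (8 / N%:R *
   \sum_(m < N) E (m%:R * u1 y) * E (m%:R * u2 y) * E (m%:R * u3 y)).
  move=> Wy; rewrite (_ : 6 = 3 * 2)%N// exprM -PE.
  pose c a := Num.truncn (N%:R * (phase y a + 3)).
  have cJ a : P a != 0 -> c a \in J.
    by rewrite !mulf_eq0 !negb_or => /andP[/andP[p1 p2] p3]; exact: hJ.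
  pose r a b := `|N%:R * (phase y a - phase y b)| <= 1.
  apply: le_trans (cells_cauchy_schwarz _ P c r J P0 cJ _) _.
    move=> a b cab; rewrite /r.
    have nn d : 0 <= N%:R * (phase y d + 3).
      by rewrite mulr_ge0//; have := phase_bound y d; rewrite ler_norml; lra.
    have := truncn_itv (nn a); have := truncn_itv (nn b).
    rewrite -/(c a) -/(c b) cab -![_.+1%:R]natr1 ler_norml; lra.
  rewrite ler_wpM2l//; apply: le_trans (collision_le _ P (phase y) N N0 P0) _.
  by under eq_bigr do rewrite enE.
rewrite mulr_sumr.
apply: (@le_trans _ _ (\sum_y (size J)%:R * (8 / N%:R) *
   \sum_(m < N) W y * (E (m%:R * u1 y) * E (m%:R * u2 y) * E (m%:R * u3 y)))).
  apply: ler_sum => y _; have [->|Wy] := eqVneq (W y) 0.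
    by rewrite mulr0 big1 ?mulr0// => m _; rewrite mul0r.
  rewrite -mulr_sumr mulrCA [leLHS]mulrC ler_wpM2l// -mulrA; exact: one.
rewrite -mulr_sumr exchange_big /= ler_wpM2l ?mulr_ge0 ?invr_ge0//.
by apply: freq_sum; rewrite subnK.
Qed.

End discrete.

(** * The determinant as a family of linear forms *)

Lemma normM_le_div {R : realType} (x d e b : R) : 0 < e -> e <= `|d| ->
  `|x * d| <= b -> `|x| <= b / e.
Proof.
move=> e0 ed; rewrite normrM ler_pdivlMr// => h; apply: le_trans h.
by rewrite ler_wpM2l.
Qed.

(** The differences of the third cofactor control b1 - b2; the sum of the
    first two is c (b2 - b1), which then gives c; and b1, b2 are recovered from
    the first two after division by c. *)
Lemma inverse_lipschitz {R : realType} (be ga e0 e b1 b2 c b1' b2' c' : R) :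
  0 < ga <= 1 -> 0 < e0 <= 1 -> 0 <= e ->
  0 <= b1' <= 1 -> 0 <= b2' <= 1 -> 0 <= c' <= 1 ->
  e0 <= `|b1 - b2| -> e0 <= c ->
  `|b2 * c - be * ga - (b2' * c' - be * ga)| <= e ->
  `|be * ga - b1 * c - (be * ga - b1' * c')| <= e ->
  `|ga * (b1 - b2) - ga * (b1' - b2')| <= e ->
  [/\ `|b1 - b1'| <= 4 / (ga * e0 ^+ 2) * e, `|b2 - b2'| <= 4 / (ga * e0 ^+ 2) * e
    & `|c - c'| <= 4 / (ga * e0 ^+ 2) * e].
Proof.
move=> /andP[ga0 ga1] /andP[e00 e01] eps0 /andP[b10 b11] /andP[b20 b21] /andP[c0 c1] he hc h1 h2 h3.
have hd : `|(b1 - b2) - (b1' - b2')| <= e / ga.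
  apply: (@normM_le_div _ _ ga) => //; first by rewrite ger0_norm// ltW.
  by move: h3; congr (`|_| <= _); ring.
have eg : e <= e / ga by rewrite ler_pdivlMr// ler_piMr.
have hcd : `|(c - c') * (b1 - b2)| <= 3 * (e / ga).
  have -> : (c - c') * (b1 - b2) = - (b2 * c - be * ga - (b2' * c' - be * ga))
     - (be * ga - b1 * c - (be * ga - b1' * c')) - c' * ((b1 - b2) - (b1' - b2')) by ring.
  have : `|c' * ((b1 - b2) - (b1' - b2'))| <= e / ga.
    by rewrite normrM (le_trans _ hd)// ler_piMl// ger0_norm.
  move: h1 h2; rewrite !ler_norml; lra.
have hc2 := normM_le_div _ _ _ _ e00 he hcd.
have X0 : 0 <= e / ga by rewrite divr_ge0// ltW.
have gX : e / ga <= e / ga / e0 by rewrite ler_pdivlMr// ler_piMr.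
have gY : e / ga / e0 <= e / ga / e0 / e0.
  by rewrite ler_pdivlMr// ler_piMr// divr_ge0// ltW.
have Y0 : 0 <= e / ga / e0 by rewrite divr_ge0// ltW.
have E : 4 / (ga * e0 ^+ 2) * e = 4 * (e / ga / e0 / e0).
  by field; rewrite !gt_eqF.
have E3 : 3 * (e / ga) / e0 = 3 * (e / ga / e0) by rewrite -mulrA.
have E4 : 4 * (e / ga / e0) / e0 = 4 * (e / ga / e0 / e0) by rewrite -mulrA.
have cc : e0 <= `|c| by apply: le_trans hc _; exact: ler_norm.
rewrite E; split; last by rewrite E3 in hc2; lra.
- rewrite -E4; apply: (normM_le_div _ _ _ _ e00 cc).
  have -> : (b1 - b1') * c = - (be * ga - b1 * c - (be * ga - b1' * c')) - b1' * (c - c') by ring.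
  have : `|b1' * (c - c')| <= 3 * (e / ga / e0).
    by rewrite -E3 normrM (le_trans _ hc2)// ler_piMl// ger0_norm.
  move: h2; rewrite !ler_norml; lra.
- rewrite -E4; apply: (normM_le_div _ _ _ _ e00 cc).
  have -> : (b2 - b2') * c = (b2 * c - be * ga - (b2' * c' - be * ga)) - b2' * (c - c') by ring.
  have : `|b2' * (c - c')| <= 3 * (e / ga / e0).
    by rewrite -E3 normrM (le_trans _ hc2)// ler_piMl// ger0_norm.
  move: h1; rewrite !ler_norml; lra.
Qed.

Section geometry.
Context {R : realType}.
Variables (rho be ga : R) (n k0 : nat) (q r : nat -> R).
Hypothesis rho_gt : 1 / 2 < rho.
Hypothesis rho_le1 : rho <= 1.
Let rho0 : 0 < rho. Proof. by apply: lt_trans rho_gt; rewrite divr_gt0. Qed.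
Hypothesis be01 : 0 <= be <= 1.
Hypothesis ga01 : 0 < ga <= 1.
Hypothesis fq : frostman_weight rho n q.
Hypothesis fr : frostman_weight rho n r.

Let D3 : finType := ('I_(2 ^ n) * 'I_(2 ^ n) * 'I_(2 ^ n))%type.
Let b1 (y : D3) : R := gridpt n y.1.1.
Let b2 (y : D3) : R := gridpt n y.1.2.
Let c3 (y : D3) : R := gridpt n y.2.

(** The region where the cofactors determine (b1, b2, c). *)
Definition good (y : D3) : bool :=
  (1 / 2 ^+ k0 <= `|b1 y - b2 y|) && (1 / 2 ^+ k0 <= c3 y).
Definition good_weight (y : D3) : R := if good y then q y.1.1 * q y.1.2 * r y.2 else 0.
Definition cofactor1 (y : D3) : R := b2 y * c3 y - be * ga.
Definition cofactor2 (y : D3) : R := be * ga - b1 y * c3 y.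
Definition cofactor3 (y : D3) : R := ga * (b1 y - b2 y).

Let q0 i : 0 <= q i. Proof. by case: fq. Qed.
Let r0 i : 0 <= r i. Proof. by case: fr. Qed.

Lemma gridpt01 (i : 'I_(2 ^ n)) : 0 <= (gridpt n i : R) <= 1.
Proof.
rewrite /gridpt divr_ge0 ?exprn_ge0//= ler_pdivrMr ?exprn_gt0// mul1r -natrX ler_nat.
exact/ltnW/ltn_ord.
Qed.

Lemma good_weight_ge0 y : 0 <= good_weight y.
Proof. by rewrite /good_weight; case: ifP => // _; rewrite !mulr_ge0. Qed.

Let mul01 (x y : R) : 0 <= x <= 1 -> 0 <= y <= 1 -> 0 <= x * y <= 1.
Proof. by move=> /andP[x0 x1] /andP[y0 y1]; rewrite mulr_ge0// mulr_ile1. Qed.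

Let ga01' : 0 <= ga <= 1.
Proof. by have /andP[/ltW -> ->] := ga01. Qed.

Lemma cofactor1_le1 y : `|cofactor1 y| <= 1.
Proof.
have := mul01 _ _ (gridpt01 y.1.2) (gridpt01 y.2); have := mul01 _ _ be01 ga01'.
rewrite /cofactor1 /b2 /c3 ler_norml; lra.
Qed.

Lemma cofactor2_le1 y : `|cofactor2 y| <= 1.
Proof.
have := mul01 _ _ (gridpt01 y.1.1) (gridpt01 y.2); have := mul01 _ _ be01 ga01'.
rewrite /cofactor2 /b1 /c3 ler_norml; lra.
Qed.

Lemma cofactor3_le1 y : `|cofactor3 y| <= 1.
Proof.
have := mul01 _ _ ga01' (gridpt01 y.1.1); have := mul01 _ _ ga01' (gridpt01 y.1.2).
rewrite /cofactor3 /b1 /b2 ler_norml mulrBr; lra.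
Qed.

Lemma sum_triple (P1 P2 P3 : pred 'I_(2 ^ n)) :
  \sum_(y : D3 | [&& P1 y.1.1, P2 y.1.2 & P3 y.2]) q y.1.1 * q y.1.2 * r y.2 =
  (\sum_(i | P1 i) q i) * (\sum_(i | P2 i) q i) * (\sum_(i | P3 i) r i).
Proof.
rewrite [\sum_(i | P1 i) _]big_mkcond [\sum_(i | P2 i) _]big_mkcond.
rewrite [\sum_(i | P3 i) _]big_mkcond [LHS]big_mkcond /=.
rewrite (eq_bigr (fun y : D3 => (if P1 y.1.1 then q y.1.1 else 0) *
   (if P2 y.1.2 then q y.1.2 else 0) * (if P3 y.2 then r y.2 else 0))); last first.
  by move=> y _; case: (P1 _); case: (P2 _); case: (P3 _); rewrite /= ?(mul0r, mulr0).
rewrite -(pair_bigA _ (fun (x : 'I_(2 ^ n) * 'I_(2 ^ n)) (j : 'I_(2 ^ n)) =>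
   (if P1 x.1 then q x.1 else 0) * (if P2 x.2 then q x.2 else 0) *
   (if P3 j then r j else 0))) /=.
rewrite -(pair_bigA _ (fun i j : 'I_(2 ^ n) => \sum_(l < 2 ^ n)
   (if P1 i then q i else 0) * (if P2 j then q j else 0) * (if P3 l then r l else 0))) /=.
rewrite -mulrA big_distrl /=; apply: eq_bigr => i _.
rewrite big_distrlr /= mulr_sumr; apply: eq_bigr => j _.
by rewrite mulr_sumr; apply: eq_bigr => l _; rewrite mulrA.
Qed.

Lemma good_weight_total : \sum_y good_weight y <= 1.
Proof.
apply: (@le_trans _ _ (\sum_(y : D3 | [&& predT y.1.1, predT y.1.2 & predT y.2])
   q y.1.1 * q y.1.2 * r y.2)).
  by apply: ler_sum => y _; rewrite /good_weight; case: ifP => // _; rewrite !mulr_ge0.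
have hq := frostman_weight_total rho n q fq; have hr := frostman_weight_total rho n r fr.
by rewrite sum_triple !mulr_ile1 ?mulr_ge0 ?sumr_ge0.
Qed.

Lemma near_mass (p : nat -> R) (k A : nat) (i0 : 'I_(2 ^ n)) : frostman_weight rho n p -> (k <= n)%N ->
  \sum_(i < 2 ^ n | `|gridpt n i - gridpt n i0| <= A%:R / 2 ^+ k :> R) p i <= (2 * A + 1)%:R * rho ^+ k.
Proof.
move=> fp kn; have [p0 _] := fp.
apply: le_trans (frostman_weight_ball rho rho_gt rho_le1 n p k A i0 fp kn).
rewrite [leLHS]big_mkcond [leRHS]big_mkcond; apply: ler_sum => i _.
case: ifP => [h|_]; last by case: ifP.
by rewrite (gridpt_dist n i i0 A k kn h).
Qed.

(** By [inverse_lipschitz], a box of side 2^-k in the space of cofactors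
    pulls back into a product of three intervals of length O(2^-k). *)
Lemma good_weight_mass (A : nat) k y0 : 4 / (ga * (1 / 2 ^+ k0) ^+ 2) <= A%:R -> (k <= n)%N ->
  good_weight y0 != 0 ->
  \sum_(y | [&& `|cofactor1 y - cofactor1 y0| <= 1 / 2 ^+ k, `|cofactor2 y - cofactor2 y0| <= 1 / 2 ^+ k &
     `|cofactor3 y - cofactor3 y0| <= 1 / 2 ^+ k]) good_weight y <= (2 * A + 1)%:R ^+ 3 * rho ^+ (3 * k).
Proof.
move=> hA kn _.
pose near (z : 'I_(2 ^ n)) : pred 'I_(2 ^ n) := fun i => `|gridpt n i - gridpt n z| <= A%:R / 2 ^+ k :> R.
apply: (@le_trans _ _ (\sum_(y : D3 | [&& near y0.1.1 y.1.1, near y0.1.2 y.1.2 & near y0.2 y.2])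
   q y.1.1 * q y.1.2 * r y.2)).
  rewrite big_mkcond [leRHS]big_mkcond; apply: ler_sum => y _.
  have nn : 0 <= (if [&& near y0.1.1 y.1.1, near y0.1.2 y.1.2 & near y0.2 y.2]
    then q y.1.1 * q y.1.2 * r y.2 else 0) by case: ifP => // _; rewrite !mulr_ge0.
  case: ifP => // /and3P[h1 h2 h3].
  rewrite /good_weight; case: ifP => // /andP[g1 g2].
  have e0 : 0 < (1 / 2 ^+ k0 : R) <= 1.
    by rewrite divr_gt0 ?exprn_gt0//= ler_pdivrMr ?exprn_gt0// mul1r exprn_ege1// ler1n.
  have e1 : 0 <= 1 / 2 ^+ k :> R by rewrite divr_ge0 ?exprn_ge0.
  have [n1 n2 n3] := inverse_lipschitz _ _ _ _ _ _ _ _ _ _ ga01 e0 e1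
     (gridpt01 y0.1.1) (gridpt01 y0.1.2) (gridpt01 y0.2) g1 g2 h1 h2 h3.
  have hA' x : x <= 4 / (ga * (1 / 2 ^+ k0) ^+ 2) * (1 / 2 ^+ k) -> x <= A%:R / 2 ^+ k.
    move=> /le_trans; apply; rewrite mulrA mulr1 ler_wpM2r// invr_ge0 exprn_ge0//.
  by rewrite /near !hA'.
rewrite sum_triple.
have -> : (2 * A + 1)%:R ^+ 3 * rho ^+ (3 * k) =
   ((2 * A + 1)%:R * rho ^+ k) * ((2 * A + 1)%:R * rho ^+ k) * ((2 * A + 1)%:R * rho ^+ k).
  by rewrite (mulnC 3 k) exprM; ring.
apply: ler_pM; rewrite ?mulr_ge0 ?sumr_ge0//; last exact: near_mass.
by apply: ler_pM; rewrite ?sumr_ge0//; exact: near_mass.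
Qed.

(** Frostman weights give little mass to the strips near b1 = b2 and c = 0. *)
Lemma good_weight_lower c : 0 <= c -> (k0 <= n)%N -> c <= \sum_(i < 2 ^ n) q i -> c <= \sum_(i < 2 ^ n) r i ->
  c ^+ 3 - 6 * rho ^+ k0 <= \sum_y good_weight y.
Proof.
move=> c0 kn cq cr.
have hq := frostman_weight_total rho n q fq; have hr := frostman_weight_total rho n r fr.
set Q := \sum_(i < 2 ^ n) q i in cq hq; set S := \sum_(i < 2 ^ n) r i in cr hr.
have Q0 : 0 <= Q by exact: le_trans cq. have S0 : 0 <= S by exact: le_trans cr.
have all : \sum_(y : D3) q y.1.1 * q y.1.2 * r y.2 = Q * Q * S.
  by have := sum_triple predT predT predT.
have lo : c ^+ 3 <= Q * Q * S.
  by rewrite (_ : c ^+ 3 = c * c * c); [rewrite !ler_pM ?mulr_ge0|ring].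
pose z0 : 'I_(2 ^ n) := Ordinal (expn_gt0 2 n : (0 < 2 ^ n)%N).
pose bad1 : pred D3 := fun y => `|gridpt n y.1.2 - gridpt n y.1.1| <= 1%:R / 2 ^+ k0 :> R.
pose bad2 : pred D3 := fun y => `|gridpt n y.2 - gridpt n z0| <= 1%:R / 2 ^+ k0 :> R.
pose F (y : D3) := q y.1.1 * q y.1.2 * r y.2.
have F0 y : 0 <= F y by rewrite !mulr_ge0.
have s1 : \sum_(y | bad1 y) F y <= 3 * rho ^+ k0.
  rewrite big_mkcond /= -(pair_bigA _ (fun (x : 'I_(2 ^ n) * 'I_(2 ^ n)) (j : 'I_(2 ^ n)) =>
     if `|gridpt n x.2 - gridpt n x.1| <= 1%:R / 2 ^+ k0 :> R then q x.1 * q x.2 * r j else 0)) /=.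
  rewrite -(pair_bigA _ (fun i j : 'I_(2 ^ n) => \sum_(l < 2 ^ n)
     if `|gridpt n j - gridpt n i| <= 1%:R / 2 ^+ k0 :> R then q i * q j * r l else 0)) /=.
  apply: (@le_trans _ _ (\sum_(i < 2 ^ n) q i * (3 * rho ^+ k0))); last first.
    by rewrite -mulr_suml ler_piMl// mulr_ge0 ?exprn_ge0 ?(ltW rho0).
  apply: ler_sum => i _.
  apply: le_trans (ler_wpM2l (q0 i) (near_mass q k0 1 i fq kn)).
  rewrite mulr_sumr [leRHS]big_mkcond; apply: ler_sum => j _.
  case: ifP => _; last by rewrite big1.
  by rewrite -mulr_sumr ler_piMr// mulr_ge0.
have s2 : \sum_(y | bad2 y) F y <= 3 * rho ^+ k0.
  have := sum_triple predT predT (fun i => `|gridpt n i - gridpt n z0| <= 1%:R / 2 ^+ k0 :> R).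
  rewrite -/Q /= => E; rewrite [leLHS]E.
  apply: le_trans (near_mass r k0 1 z0 fr kn).
  by rewrite ler_piMl ?sumr_ge0// mulr_ile1.
have : Q * Q * S <= \sum_y good_weight y + \sum_(y | bad1 y) F y + \sum_(y | bad2 y) F y; last by lra.
rewrite -all (big_mkcond bad1) (big_mkcond bad2) -!big_split /=; apply: ler_sum => y _.
have w0 := good_weight_ge0 y; rewrite -/(F y).
have i0 (b : bool) : 0 <= (if b then F y else 0) by case: b.
case: ifP => B1; first by rewrite addrAC lerDr addr_ge0// i0.
case: ifP => B2; first by rewrite addr0 lerDr.
rewrite !addr0 /good_weight /good.
have -> : 1 / 2 ^+ k0 <= `|b1 y - b2 y|.
  by move: B1; rewrite /bad1 distrC => /negbT; rewrite -ltNge => /ltW.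
suff -> : 1 / 2 ^+ k0 <= c3 y by [].
move: B2; rewrite /bad2 /c3 {2}/gridpt mul0r subr0 ger0_norm; last by have /andP[] := gridpt01 y.2.
by move/negbT; rewrite -ltNge => /ltW.
Qed.

End geometry.

Theorem cells_count_lower {R : realType} (rho c be ga : R) :
  1 / 2 < rho -> rho < 1 -> 16 * rho ^+ 6 < 1 -> 0 < c -> 0 <= be <= 1 -> 0 < ga <= 1 ->
  exists2 e : R, 0 < e & exists n0 : nat, forall n, (n0 <= n)%N -> forall p q r : nat -> R,
    frostman_weight rho n p -> frostman_weight rho n q -> frostman_weight rho n r ->
    c <= \sum_(i < 2 ^ n) p i -> c <= \sum_(i < 2 ^ n) q i -> c <= \sum_(i < 2 ^ n) r i ->
    forall J : seq nat,
    (forall a1 a2 a3 i1 i2 i3 : 'I_(2 ^ n), p a1 != 0 -> p a2 != 0 -> p a3 != 0 ->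
       q i1 != 0 -> q i2 != 0 -> r i3 != 0 ->
       Num.truncn (2 ^+ (n - 2) * (gridpt n a1 * (gridpt n i2 * gridpt n i3 - be * ga)
         + gridpt n a2 * (be * ga - gridpt n i1 * gridpt n i3) + gridpt n a3 * (ga * (gridpt n i1 - gridpt n i2)) + 3))
         \in J) ->
    e * 2 ^+ (n - 2) <= (size J)%:R.
Proof.
move=> rho1 rho2 rho6 c0 be01 ga01.
have rho0 : 0 < rho by apply: lt_trans rho1; rewrite divr_gt0.
(* The strips of width 2^-k0 excluded by [good] weigh at most c^3 / 2. *)
have [k0 hk0] : exists k0, 6 * rho ^+ k0 <= c ^+ 3 / 2.
  have r1 : `|rho| < 1 by rewrite ger0_norm ?(ltW rho0).
  have c30 : 0 < c ^+ 3 / 12 by rewrite divr_gt0 ?exprn_gt0.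
  have /cvgrPdist_lt/(_ _ c30)[k0 _ /(_ k0 (leqnn _))] := cvg_expr r1.
  rewrite /= sub0r normrN ger0_norm ?exprn_ge0 ?(ltW rho0)// => h.
  by exists k0; lra.
pose A := (Num.truncn (4 / (ga * (1 / 2 ^+ k0) ^+ 2) : R)).+1.
have hA : 4 / (ga * (1 / 2 ^+ k0) ^+ 2) <= A%:R.
  have ga0 : 0 < ga by case/andP: ga01.
  have /truncn_itv/andP[_ /ltW//] : 0 <= 4 / (ga * (1 / 2 ^+ k0) ^+ 2).
  by rewrite divr_ge0// mulr_ge0 ?(ltW ga0)// exprn_ge0// divr_ge0// exprn_ge0.
pose H : R := (2 * A + 1)%:R ^+ 3.
have H0 : 0 <= H by rewrite exprn_ge0.
have [C C0 EC] : exists2 C : R, 0 <= C & C = 12288.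
  by exists 12288; [exact: ler0n|reflexivity].
pose S : R := 1 + H * C ^+ 3 / (1 - 16 * rho ^+ 6).
have S0 : 0 < S.
  by rewrite ltr_wpDr// divr_ge0 ?subr_ge0 ?(ltW rho6)// mulr_ge0// exprn_ge0.
have c30 : 0 < c ^+ 3 by rewrite exprn_gt0.
exists (c ^+ 6 * (c ^+ 3 / 2) / (8 * S)).
  by rewrite divr_gt0 ?mulr_gt0 ?exprn_gt0 ?divr_gt0.
exists (maxn 2 k0) => n; rewrite geq_max => /andP[n2 kn] p q r fp fq fr cp cq cr J hJ.
have CS m k : (2 ^ k <= m < 2 ^ k.+1)%N -> (k + 2 <= n)%N ->
    \sum_(i < 2 * m + 1) local_majorant n p (i%:R - m%:R) <= C * (2 * rho) ^+ k.
  by rewrite EC; apply: local_majorant_sum_center => //; exact: ltW.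
have := discrete_main rho rho1 rho6 n p fp _ (good_weight n k0 q r) (cofactor1 be ga n) (cofactor2 be ga n)
   (cofactor3 ga n) H (good_weight_ge0 rho n k0 q r fq fr) (good_weight_total rho n k0 q r fq fr) H0
   (cofactor1_le1 be ga n be01 ga01) (cofactor2_le1 be ga n be01 ga01) (cofactor3_le1 ga n ga01)
   (fun k y0 => good_weight_mass rho be ga n k0 q r rho1 (ltW rho2) ga01 fq fr A k y0 hA) C C0 CS J n2.
have cond : forall (a : 'I_(2 ^ n) * 'I_(2 ^ n) * 'I_(2 ^ n)) y,
   p a.1.1 != 0 -> p a.1.2 != 0 -> p a.2 != 0 -> good_weight n k0 q r y != 0 ->
   Num.truncn (2 ^+ (n - 2) * (gridpt n a.1.1 * cofactor1 be ga n y + gridpt n a.1.2 * cofactor2 be ga n y +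
      gridpt n a.2 * cofactor3 ga n y + 3)) \in J.
  move=> a y p1 p2 p3; rewrite /good_weight; case: ifP; last by rewrite eqxx.
  by move=> _; rewrite !mulf_eq0 !negb_or => /andP[/andP[q1 q2] r3]; exact: hJ.
move=> /(_ cond).
have wl := good_weight_lower rho n k0 q r rho1 (ltW rho2) fq fr c (ltW c0) kn cq cr.
have wl' : c ^+ 3 / 2 <= \sum_y good_weight n k0 q r y.
  by apply: le_trans wl; clear -hk0; lra.
have p6 : c ^+ 6 <= (\sum_(i < 2 ^ n) p i) ^+ 6.
  by rewrite ler_pXn2r ?nnegrE ?(ltW c0)// (le_trans (ltW c0)).
have N0 : 0 < 2 ^+ (n - 2) :> R by rewrite exprn_gt0.
have lo : c ^+ 6 * (c ^+ 3 / 2) <= (\sum_(i < 2 ^ n) p i) ^+ 6 * \sum_y good_weight n k0 q r y.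
  by rewrite ler_pM ?exprn_ge0 ?(ltW c0)// divr_ge0// ltW.
move=> /(le_trans lo); rewrite -/S => h.
rewrite mulrAC ler_pdivrMr ?mulr_gt0//.
have -> : (size J)%:R * (8 * S) = (size J)%:R * (8 / 2 ^+ (n - 2)) * S * 2 ^+ (n - 2).
  by field; rewrite gt_eqF.
by rewrite ler_wpM2r// ltW.
Qed.

(** * From Hausdorff dimension to net content *)

Lemma completed_lebesgue_measure_le {R : realType} (A B : set R) : A `<=` B ->
  (lebesgue_measure A <= completed_lebesgue_measure B)%E.
Proof. by move=> AB; exact: (@le_mu_ext _ _ _ (wlength idfun) _ _ AB). Qed.

Section hausdorff_content.
Context {R : realType}.
Implicit Types (A : set R) (s : R).

Lemma diam_le A (d : R) : (forall x y, A x -> A y -> `|x - y| <= d) ->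
  (diam A <= d%:E)%E.
Proof.
move=> H; apply: ge_ereal_sup => _ [x Ax [y Ay <-]].
by rewrite lee_fin; exact: H.
Qed.

Lemma hausdorff_weight_ge0 s A : (0 <= hausdorff_weight s A)%E.
Proof. by rewrite /hausdorff_weight; case: ifP => // _; exact: poweR_ge0. Qed.

(** The power is monotone on nonnegative bases, and the diameter of a
    nonempty set is nonnegative. *)
Lemma hausdorff_weight_le s A (d : R) : 0 < s -> 0 <= d ->
  (forall x y, A x -> A y -> `|x - y| <= d) ->
  (hausdorff_weight s A <= (d `^ s)%:E)%E.
Proof.
move=> s0 d0 H; rewrite /hausdorff_weight; case: ifPn => [_|/set0P[x Ax]].
  by rewrite lee_fin powR_ge0.
have dge0 : (0 <= diam A)%E.
  apply: ereal_sup_ubound; exists x => //; exists x => //.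
  by rewrite subrr normr0.
rewrite -poweR_EFin; apply: gt0_ler_poweR => //; first exact: ltW.
- by rewrite in_itv /= dge0 leey.
- by rewrite in_itv /= lee_fin d0 leey.
- exact: diam_le.
Qed.

Definition dyadic (q : nat * nat) : set R := [set x | 0 <= x < 1 /\ dyadic_idx q.1 x = q.2].

Lemma dyadic_diam q x y : dyadic q x -> dyadic q y -> `|x - y| <= 1 / 2 ^+ q.1.
Proof.
move=> [/andP[x0 _] xq] [/andP[y0 _] yq].
have := dyadic_idx_itv q.1 x x0; have := dyadic_idx_itv q.1 y y0; rewrite xq yq -[_.+1%:R]natr1.
have p0 : 0 < 2 ^+ q.1 :> R by rewrite exprn_gt0.
move=> b a; have : `|(x - y) * 2 ^+ q.1| <= 1 by rewrite ler_norml; lra.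
by rewrite normrM (gtr0_norm p0) ler_pdivlMr.
Qed.

(** The weight ratio of net content that corresponds to dimension s. *)
Definition rate s : R := 2 `^ (- s).

Lemma rate_gt0 s : 0 < rate s. Proof. by rewrite powR_gt0. Qed.

Lemma powR2_lt (a b : R) : a < b -> 2 `^ a < 2 `^ b :> R.
Proof.
move=> ab; have ba : 0 < b - a by rewrite subr_gt0.
rewrite (_ : b = a + (b - a)); last by ring.
rewrite powRD; last by rewrite pnatr_eq0 implybT.
rewrite ltr_pMr ?powR_gt0//.
have := gt0_ltr_powR ba (x := 1) (y := 2).
by rewrite powR1; apply; rewrite ?nnegrE ?ler01 ?ler0n ?ltr1n.
Qed.

Lemma rate_lt1 s : 0 < s -> rate s < 1.
Proof.
by move=> s0; have := powR2_lt (- s) 0; rewrite oppr_lt0 powRr0; exact.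
Qed.

Lemma rateX s k : (1 / 2 ^+ k) `^ s = rate s ^+ k.
Proof.
have -> : 1 / 2 ^+ k = 2 `^ (- k%:R) :> R by rewrite powRN powR_mulrn// div1r.
by rewrite -powRrM -powR_mulrn ?powR_ge0// -powRrM; congr (_ `^ _); ring.
Qed.

(** Dyadic covers of small total weight consist of intervals of high
    generation, hence of small diameter, and so bound the Hausdorff contents at
    every scale.  The point 1, which no dyadic interval of [0, 1) covers, is added
    to them at no cost, as s > 0. *)
Lemma hausdorff_measure0 s A : 0 < s -> A `<=` `[0, 1] ->
  net_content (rate s) (A `&` [set x | 0 <= x < 1]) <= 0 -> hausdorff_measure s A = 0%E.
Proof.
move=> s0 A01 c0; set A' := A `&` _ in c0.
have A'01 : A' `<=` [set x : R | 0 <= x < 1] by move=> x [].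
have r0 := rate_gt0 s; have r1 := rate_lt1 _ s0.
have key (delta e : R) : 0 < delta -> 0 < e -> (hausdorff_content s delta A <= e%:E)%E.
  move=> d0 e0.
  have [m hm] : exists m, 1 / 2 ^+ m <= delta.
    have h : `|1 / 2 : R| < 1 by rewrite ger0_norm; lra.
    have /cvgrPdist_lt/(_ _ d0)[m _ /(_ m (leqnn _))] := cvg_expr h.
    rewrite /= sub0r normrN ger0_norm ?exprn_ge0// => hm.
    by exists m; rewrite (_ : 1 / 2 ^+ m = (1 / 2) ^+ m) ?ltW// expr_div_n expr1n.
  (* A node of weight below rate s ^+ m has generation above m, hence diameter below delta. *)
  pose e' := Num.min e (rate s ^+ m).
  have e'0 : 0 < e' by rewrite lt_min e0 exprn_gt0.
  have e'2 : 0 < e' / 2 by rewrite divr_gt0.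
  have [U [cU costU]] := net_content_approx (rate s) A' (e' / 2) A'01 e'2.
  have {}costU : cost_le (rate s) U (e' / 2).
    by move=> L uL hL; apply: le_trans (costU L uL hL) _; rewrite gerDr.
  have Um q : U q -> (m <= q.1)%N.
    move=> Uq; have : \sum_(p <- [:: q]) rate s ^+ p.1 <= e' / 2.
      by apply: costU => // p; rewrite inE => /eqP->.
    rewrite big_seq1 => h; rewrite leqNgt; apply/negP => qm.
    have : rate s ^+ m <= rate s ^+ q.1 by rewrite ler_wiXn2l ?(ltW r0) ?(ltW r1) ?(ltnW qm).
    have : e' <= rate s ^+ m by rewrite ge_min lexx orbT.
    lra.
  (* The singleton [set 1] has weight 0 ^ s = 0. *)
  pose V (i : nat) : set R := match i with 0%N => [set 1] | i.+1 =>
     if pickle_inv i is Some q then (if `[< U q >] then dyadic q else set0) else set0 end.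
  have h0 : A `<=` \bigcup_i V i.
    move=> x Ax; have := A01 _ Ax; rewrite /= in_itv /= => /andP[x0].
    rewrite le_eqVlt => /orP[/eqP->|x1]; first by exists 0%N.
    have A'x : A' x by split=> //=; rewrite x0.
    have [k Uk] := cU _ A'x; exists (pickle (k, dyadic_idx k x)).+1 => //=.
    by rewrite pickleK_inv asboolT//; split=> //; rewrite x0.
  have h1 i : (diam (V i) <= delta%:E)%E.
    apply: diam_le => x y; case: i => [-> -> |i] /=; first by rewrite subrr normr0 ltW.
    case: pickle_inv => [q|//]; case: ifP => // /asboolP Uq xq yq.
    apply: le_trans (dyadic_diam q x y xq yq) _; apply: le_trans hm.
    by rewrite ler_pM2l// lef_pV2 ?posrE ?exprn_gt0// ler_weXn2l ?ler1n// Um.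
  pose wq (i : nat) : R := if pickle_inv i is Some q then
     (if `[< U q >] then rate s ^+ q.1 else 0) else 0.
  have wV i : (hausdorff_weight s (V i.+1) <= (wq i)%:E)%E.
    rewrite /wq /=; case: pickle_inv => [q|]; last first.
      by rewrite /hausdorff_weight eqxx.
    case: ifP => _; last by rewrite /hausdorff_weight eqxx.
    rewrite -rateX; apply: hausdorff_weight_le => //.
    by move=> x y; exact: dyadic_diam.
  have wV0 : hausdorff_weight s (V 0%N) = 0%E.
    apply/eqP; rewrite eq_le hausdorff_weight_ge0 andbT.
    have -> : 0%E = (0 `^ s)%:E :> \bar R by rewrite powR0// gt_eqF.
    by apply: hausdorff_weight_le => // x y /= -> ->; rewrite subrr normr0.
  have wsum n : \sum_(i < n) wq i <= e' / 2.
    pose sel (i : nat) : option (nat * nat) :=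
      if pickle_inv i is Some q then (if `[< U q >] then Some q else None) else None.
    have selE i q : sel i = Some q -> U q.
      by rewrite /sel; case: pickle_inv => [p|//]; case: ifP => // /asboolP Up [<-].
    have selK : ocancel sel pickle.
      move=> i; have := @pickle_invK (nat * nat)%type i; rewrite /sel; case: pickle_inv => [q|//] /= E.
      by case: ifP.
    have -> : \sum_(i < n) wq i = \sum_(q <- pmap sel (iota 0 n)) rate s ^+ q.1.
      rewrite -(big_mkord predT) /index_iota subn0 /=.
      elim: (iota 0 n) => [|i t IH]; first by rewrite !big_nil.
      rewrite big_cons IH /= /wq /sel; case: pickle_inv => [q|] /=; last by rewrite add0r.
      by case: ifP => _ /=; rewrite ?add0r ?big_cons.
    apply: costU.
      by apply: (pmap_uniq selK); exact: iota_uniq.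
    by move=> q; rewrite mem_pmap => /mapP[i _ /esym/selE].
  have h2 : (\sum_(0 <= i <oo) hausdorff_weight s (V i) <= e%:E)%E.
    apply: lime_le; first by apply: is_cvg_nneseries => i _ _; exact: hausdorff_weight_ge0.
    apply: nearW => n; apply: (@le_trans _ _ (\sum_(0 <= i < n.+1) hausdorff_weight s (V i))%E).
      rewrite big_nat_recr//= leeDl//; exact: hausdorff_weight_ge0.
    rewrite big_nat_recl//= wV0 add0e.
    apply: (@le_trans _ _ (\sum_(0 <= i < n) (wq i)%:E)%E).
      by apply: lee_sum => i _; exact: wV.
    rewrite sumEFin lee_fin big_mkord (le_trans (wsum n))//.
    by apply: (@le_trans _ _ e'); [lra|rewrite ge_min lexx].
  apply: le_trans h2; apply: ereal_inf_lbound; exists V => //; split.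
apply/eqP; rewrite eq_le; apply/andP; split.
  apply: ge_ereal_sup => _ [delta /= d0 <-]; apply/lee_addgt0Pr => e e0.
  by rewrite add0e; exact: key.
apply: le_trans (_ : (0 <= hausdorff_content s 1 A)%E) _.
  apply: le_ereal_inf_tmp => _ [V _ <-].
  by apply: nneseries_ge0 => i _ _; exact: hausdorff_weight_ge0.
by apply: ereal_sup_ubound; exists 1 => //=.
Qed.

Lemma net_content_gt0 s A : 0 < s -> A `<=` `[0, 1] -> (s%:E < hausdorff_dim A)%E ->
  0 < net_content (rate s) (A `&` [set x | 0 <= x < 1]).
Proof.
move=> s0 A01; rewrite ltNge => /negP sd; rewrite ltNge; apply/negP => c0; apply: sd.
by apply: ereal_inf_lbound; exists s => //=; split; [exact: ltW|exact: hausdorff_measure0].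
Qed.

End hausdorff_content.

(** * From counting cells to Lebesgue measure *)

(** Compactness makes the radius of a ball inside O uniform over K. *)
Lemma compact_open_margin {R : realType} (K O : set R) : compact K -> open O ->
  K `<=` O -> exists2 d : R, 0 < d & forall v z, K v -> `|z - v| < d -> O z.
Proof.
move=> /compact_near_coveringP cK oO KO.
have := cK nat \oo (fun n v => forall z, `|z - v| < n.+1%:R^-1 -> O z) _.
case.
  move=> x Kx; have /= := oO; rewrite openE => /(_ x (KO x Kx)) /nbhs_ballP[e /= e0 eO].
  have e20 : 0 < e / 2 by rewrite divr_gt0.
  exists (ball x (e / 2), [set n | n.+1%:R^-1 < e / 2]).
    split; first exact: nbhsx_ballx.
    exact: near_infty_natSinv_lt (PosNum e20).
  move=> [v n] [/= xv ne] z zv; apply: eO.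
  have {}xv : `|x - v| < e / 2 := xv; have {}ne : n.+1%:R^-1 < e / 2 := ne.
  rewrite /ball /=.
  rewrite (_ : x - z = (x - v) - (z - v)); last by ring.
  apply: le_lt_trans (ler_normB _ _) _; rewrite (splitr e).
  by apply: ltrD => //; exact: lt_trans ne.
move=> n _ /(_ n (leqnn _)) Hn; exists n.+1%:R^-1; first by rewrite invr_gt0 ltr0Sn.
by move=> v z Kv; exact: Hn.
Qed.

Lemma cells_measure_le {R : realType} (O : set R) (N : R) (J : seq nat) :
  measurable O -> 0 < N -> uniq J ->
  (forall j, j \in J -> `[j%:R / N - 3, (j%:R + 1) / N - 3[ `<=` O) ->
  (((size J)%:R / N)%:E <= lebesgue_measure O)%E.
Proof.
move=> mO N0 uJ JO.
pose F (j : nat) : set R := `[j%:R / N - 3, (j%:R + 1) / N - 3[%classic.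
have FE j : lebesgue_measure (F j) = (N^-1)%:E.
  rewrite lebesgue_measure_itv /= lte_fin ifT; last first.
    by rewrite ltrD2r ltr_pM2r ?invr_gt0// ltrDl.
  by rewrite -EFinB; congr _%:E; ring.
have : (lebesgue_measure (\bigcup_(j in [set` J]) F j) <= lebesgue_measure O)%E.
  apply: le_measure; rewrite ?inE//.
    by apply: fin_bigcup_measurable => // j _; exact: measurable_itv.
  by move=> x [j /= jJ]; exact: JO.
have fJ : finite_set [set` J] by exact: finite_seq.
apply: le_trans; rewrite measure_fin_bigcup//.
- rewrite -fsbig_seq// (eq_bigr (fun=> (N^-1)%:E)); last by move=> j _; exact: FE.
  rewrite sumEFin lee_fin big_const_seq count_predT iter_addr_0.
  by rewrite mulr_natl.
- move=> i j _ _ [x [Fi Fj]]; move: Fi Fj; rewrite /F /= !in_itv /=.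
  move=> /andP[a b] /andP[c d].
  have iN : i%:R < (j%:R + 1 : R).
    by rewrite -(ltr_pM2r (_ : 0 < N^-1)) ?invr_gt0//; lra.
  have jN : j%:R < (i%:R + 1 : R).
    by rewrite -(ltr_pM2r (_ : 0 < N^-1)) ?invr_gt0//; lra.
  move: iN jN; rewrite !natr1 !ltr_nat; lia.
- by move=> j _; exact: measurable_itv.
Qed.

Lemma det_form_lipschitz {R : realType} (be ga h a1 a2 a3 b1 b2 c a1' a2' a3' b1' b2' c' : R) :
  0 <= be <= 1 -> 0 <= ga <= 1 -> 0 <= h ->
  0 <= a1 <= 1 -> 0 <= a2 <= 1 -> 0 <= a3 <= 1 -> 0 <= b1 <= 1 -> 0 <= b2 <= 1 -> 0 <= c <= 1 ->
  0 <= a1' <= 1 -> 0 <= a2' <= 1 -> 0 <= a3' <= 1 -> 0 <= b1' <= 1 -> 0 <= b2' <= 1 -> 0 <= c' <= 1 ->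
  `|a1 - a1'| <= h -> `|a2 - a2'| <= h -> `|a3 - a3'| <= h ->
  `|b1 - b1'| <= h -> `|b2 - b2'| <= h -> `|c - c'| <= h ->
  `|a1 * (b2 * c - be * ga) + a2 * (be * ga - b1 * c) + a3 * (ga * (b1 - b2)) -
    (a1' * (b2' * c' - be * ga) + a2' * (be * ga - b1' * c') + a3' * (ga * (b1' - b2')))|
  <= 9 * h.
Proof.
move=> be1 ga1 h0 A1 A2 A3 B1 B2 C A1' A2' A3' B1' B2' C' dA1 dA2 dA3 dB1 dB2 dC.
have prod (x y x' y' e f : R) : `|x'| <= 1 -> `|y| <= 1 -> `|x - x'| <= e -> `|y - y'| <= f ->
   `|x * y - x' * y'| <= e + f.
  move=> hx hy he hf.
  have -> : x * y - x' * y' = (x - x') * y + x' * (y - y') by ring.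
  apply: le_trans (ler_normD _ _) _; rewrite !normrM; apply: lerD.
    by apply: le_trans he; rewrite ler_piMr.
  by apply: le_trans hf; rewrite ler_piMl.
have n01 (x : R) : 0 <= x <= 1 -> `|x| <= 1.
  by move=> /andP[x0 x1]; rewrite ger0_norm.
have mul01 (x y : R) : 0 <= x <= 1 -> 0 <= y <= 1 -> 0 <= x * y <= 1.
  by move=> /andP[x0 x1] /andP[y0 y1]; rewrite mulr_ge0// mulr_ile1.
have sub01 (x y : R) : 0 <= x <= 1 -> 0 <= y <= 1 -> `|x - y| <= 1.
  by rewrite ler_norml; lra.
have bega := mul01 _ _ be1 ga1.
have d1 : `|(b2 * c - be * ga) - (b2' * c' - be * ga)| <= h + h.
  rewrite (_ : b2 * c - be * ga - (b2' * c' - be * ga) = b2 * c - b2' * c'); last by ring.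
  by apply: prod => //; exact: n01.
have d2 : `|(be * ga - b1 * c) - (be * ga - b1' * c')| <= h + h.
  rewrite (_ : be * ga - b1 * c - (be * ga - b1' * c') = - (b1 * c - b1' * c')); last by ring.
  by rewrite normrN; apply: prod => //; exact: n01.
have d3 : `|ga * (b1 - b2) - ga * (b1' - b2')| <= 0 + (h + h).
  apply: prod; [exact: n01|exact: sub01|by rewrite subrr normr0|].
  rewrite (_ : b1 - b2 - (b1' - b2') = (b1 - b1') - (b2 - b2')); last by ring.
  by apply: le_trans (ler_normB _ _) _; apply: lerD.
have p1 := prod _ _ _ _ _ _ (n01 _ A1') (sub01 _ _ (mul01 _ _ B2 C) bega) dA1 d1.
have p2 := prod _ _ _ _ _ _ (n01 _ A2') (sub01 _ _ bega (mul01 _ _ B1 C)) dA2 d2.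
have p3 : `|a3 * (ga * (b1 - b2)) - a3' * (ga * (b1' - b2'))| <= h + (0 + (h + h)).
  apply: prod => //; first exact: n01.
  by rewrite normrM mulr_ile1//; [exact: n01|exact: sub01].
move: p1 p2 p3; rewrite !ler_norml; lra.
Qed.

Section assembly.
Context {R : realType}.
Variables (rho c : R).
Hypothesis rho_gt0 : 0 < rho.
Hypothesis rho_lt1 : rho < 1.
Hypothesis c_gt0 : 0 < c.

(** Compact sets that carry Frostman weights of total mass at least c at every
    scale, by [discrete_frostman]. *)
Definition thick (K : set R) := [/\ closed K, K `<=` [set x | 0 <= x < 1] &
  forall U b, covers U K -> cost_le rho U b -> c <= b].

Lemma thick_compact K : thick K -> compact K.
Proof.
move=> [cK K01 _]; apply: (subclosed_compact cK (@segment_compact R 0 1)).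
by move=> x /K01 /andP[x0 x1] /=; rewrite in_itv /= x0 ltW.
Qed.

(** A single point has content 0. *)
Lemma thick_pos K : thick K -> exists2 x, K x & 0 < x.
Proof.
move=> [_ K01 KU]; apply: contrapT => H.
have [m hm] : exists m, rho ^+ m < c.
  have r1 : `|rho| < 1 by rewrite gtr0_norm.
  have /cvgrPdist_lt/(_ _ c_gt0)[m _ /(_ m (leqnn _))] := cvg_expr r1.
  by rewrite /= sub0r normrN gtr0_norm ?exprn_gt0// => ?; exists m.
suff : c <= rho ^+ m by rewrite leNgt hm.
apply: (KU [set (m, 0%N)]).
  move=> x Kx; exists m; congr (_, _); apply: dyadic_idx_eq.
  have /andP[x0 _] := K01 _ Kx.
  have -> : x = 0.
    apply/eqP; rewrite eq_le x0 andbT leNgt; apply/negP => xp; apply: H; by exists x.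
  by rewrite mul0r lexx ltr0n.
move=> L uL hL; apply: (@le_trans _ _ (\sum_(q <- [:: (m, 0%N)]) rho ^+ q.1)).
  by apply: le_sum_uniq_sub => // [q|q /hL /= ->]; [rewrite exprn_ge0// ltW|rewrite inE].
by rewrite big_seq1.
Qed.

(** The determinant with columns (a1, b1, ga), (a2, b2, ga), (a3, be, c), for
    x = (a1, a2, a3, (b1, b2, c)). *)
Definition det_form (be ga : R) (x : R * R * R * (R * R * R)) : R :=
  x.1.1.1 * (x.2.1.2 * x.2.2 - be * ga) + x.1.1.2 * (be * ga - x.2.1.1 * x.2.2)
  + x.1.2 * (ga * (x.2.1.1 - x.2.1.2)).

Lemma det_form_continuous be ga : continuous (det_form be ga).
Proof.
have c1 : continuous (fun x : R * R * R * (R * R * R) => x.1.1.1).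
  move=> x; apply: (continuous_comp (f := fun x => x.1.1) (g := fst)); last exact: cvg_fst.
  by apply: (continuous_comp (f := fst) (g := fst)); exact: cvg_fst.
have c2 : continuous (fun x : R * R * R * (R * R * R) => x.1.1.2).
  move=> x; apply: (continuous_comp (f := fun x => x.1.1) (g := snd)); last exact: cvg_snd.
  by apply: (continuous_comp (f := fst) (g := fst)); exact: cvg_fst.
have c3 : continuous (fun x : R * R * R * (R * R * R) => x.1.2).
  by move=> x; apply: (continuous_comp (f := fst) (g := snd)); [exact: cvg_fst|exact: cvg_snd].
have c4 : continuous (fun x : R * R * R * (R * R * R) => x.2.1.1).
  move=> x; apply: (continuous_comp (f := fun x => x.2.1) (g := fst)); last exact: cvg_fst.
  by apply: (continuous_comp (f := snd) (g := fst)); [exact: cvg_snd|exact: cvg_fst].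
have c5 : continuous (fun x : R * R * R * (R * R * R) => x.2.1.2).
  move=> x; apply: (continuous_comp (f := fun x => x.2.1) (g := snd)); last exact: cvg_snd.
  by apply: (continuous_comp (f := snd) (g := fst)); [exact: cvg_snd|exact: cvg_fst].
have c6 : continuous (fun x : R * R * R * (R * R * R) => x.2.2).
  by move=> x; apply: (continuous_comp (f := snd) (g := snd)); exact: cvg_snd.
move=> x; apply: cvgD; first apply: cvgD.
- apply: cvgM; first exact: c1; apply: cvgB; last exact: cvg_cst.
  by apply: cvgM; [exact: c5|exact: c6].
- apply: cvgM; first exact: c2; apply: cvgB; first exact: cvg_cst.
  by apply: cvgM; [exact: c4|exact: c6].
- apply: cvgM; first exact: c3; apply: cvgM; first exact: cvg_cst.
  by apply: cvgB; [exact: c4|exact: c5].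
Qed.

End assembly.

(** * Positive measure of the volume set *)

Lemma gridpt_dist_idx {R : realType} n (x : R) : 0 <= x -> `|gridpt n (dyadic_idx n x) - x| <= 1 / 2 ^+ n.
Proof.
move=> x0; have := dyadic_idx_itv n x x0; rewrite -[_.+1%:R]natr1 /gridpt => /andP[a b].
have p0 : 0 < 2 ^+ n :> R by rewrite exprn_gt0.
have h : `|(dyadic_idx n x)%:R - x * 2 ^+ n| <= 1 by rewrite ler_norml; lra.
by rewrite ler_pdivlMr// -[X in _ * X](gtr0_norm p0) -normrM mulrBl divfK ?gt_eqF.
Qed.

Lemma det_form_le3 {R : realType} (be ga : R) (x : R * R * R * (R * R * R)) :
  0 <= be <= 1 -> 0 <= ga <= 1 -> 0 <= x.1.1.1 <= 1 -> 0 <= x.1.1.2 <= 1 ->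
  0 <= x.1.2 <= 1 -> 0 <= x.2.1.1 <= 1 -> 0 <= x.2.1.2 <= 1 -> 0 <= x.2.2 <= 1 ->
  `|det_form be ga x| <= 3.
Proof.
move=> be1 ga1 h1 h2 h3 h4 h5 h6.
have mul01 (s t : R) : 0 <= s <= 1 -> 0 <= t <= 1 -> 0 <= s * t <= 1.
  by move=> /andP[x0 x1] /andP[y0 y1]; rewrite mulr_ge0// mulr_ile1.
have sub01 (s t : R) : 0 <= s <= 1 -> 0 <= t <= 1 -> `|s - t| <= 1.
  by rewrite ler_norml; lra.
have sc (s t : R) : 0 <= s <= 1 -> `|t| <= 1 -> `|s * t| <= 1.
  by move=> /andP[s0 s1] t1; rewrite normrM mulr_ile1// ger0_norm.
have t1 := sc _ _ h1 (sub01 _ _ (mul01 _ _ h5 h6) (mul01 _ _ be1 ga1)).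
have t2 := sc _ _ h2 (sub01 _ _ (mul01 _ _ be1 ga1) (mul01 _ _ h4 h6)).
have t3 := sc _ _ h3 (sc _ _ ga1 (sub01 _ _ h4 h5)).
rewrite /det_form; move: t1 t2 t3; rewrite !ler_norml; lra.
Qed.

Section assembly.
Context {R : realType}.
Variables (rho c : R).
Hypothesis rho1 : 1 / 2 < rho.
Hypothesis rho2 : rho < 1.
Hypothesis rho6 : 16 * rho ^+ 6 < 1.
Hypothesis c_gt0 : 0 < c.

Let rho0 : 0 < rho. Proof. by apply: lt_trans rho1; rewrite divr_gt0. Qed.

(** If the image were null, a neighbourhood of it would have measure less
    than the constant e of [cells_count_lower]; but at a fine scale the cells of
    the grid values lie within this neighbourhood and have total length at least
    e. *)
Lemma image_measure_gt0 (K1 K2 K3 : set R) (be ga : R) :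
  thick rho c K1 -> thick rho c K2 -> thick rho c K3 -> K2 be -> K3 ga -> 0 < ga ->
  (0 < lebesgue_measure (det_form be ga @` ((K1 `*` K1 `*` K1) `*` (K2 `*` K2 `*` K3))))%E.
Proof.
move=> tK1 tK2 tK3 Kbe Kga ga0; set V := det_form be ga @` _.
have [_ K101 K1c] := tK1; have [_ K201 K2c] := tK2; have [_ K301 K3c] := tK3.
have be01 : 0 <= be <= 1 by have /andP[-> /ltW ->] := K201 _ Kbe.
have ga01 : 0 < ga <= 1 by have /andP[_ /ltW ->] := K301 _ Kga; rewrite ga0.
have ga01' : 0 <= ga <= 1 by rewrite (ltW ga0); case/andP: ga01.
have [e e0 [n0 Hn]] := cells_count_lower rho c be ga rho1 rho2 rho6 c_gt0 be01 ga01.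
rewrite ltNge; apply/negP => V0.
have cV : compact V.
  apply: continuous_compact; first exact/continuous_subspaceT/det_form_continuous.
  have cK1 := thick_compact _ _ _ tK1; have cK2 := thick_compact _ _ _ tK2.
  have cK3 := thick_compact _ _ _ tK3.
  apply: compact_setX; apply: compact_setX => //; exact: compact_setX.
have mV : measurable V by apply: measurable_realfun.closed_measurable; exact: compact_closed.
have V0' : lebesgue_measure V = 0%E.
  by apply/eqP; rewrite eq_le V0 measure_ge0.
have Vfin : (lebesgue_measure V < +oo)%E by rewrite V0' ltey.
have [W [oO VO mO]] := lebesgue_regularity_outer mV Vfin e0.
have mO' : measurable W by exact: measurable_realfun.open_measurable.
have Oe : (lebesgue_measure W < e%:E)%E.
  apply: le_lt_trans mO; rewrite -[leRHS]add0e -V0'.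
  rewrite -[W in leLHS](setDUK VO); apply: measureU2 => //.
  exact: measurableD.
have [d d0 Hd] := compact_open_margin V W cV oO VO.
have [m hm] : exists m, 4 / 2 ^+ m < d.
  have h : `|1 / 2 : R| < 1 by rewrite ger0_norm; lra.
  have d4 : 0 < d / 4 by rewrite divr_gt0.
  have /cvgrPdist_lt/(_ _ d4)[m _ /(_ m (leqnn _))] := cvg_expr h.
  rewrite /= sub0r normrN ger0_norm ?exprn_ge0// => hm; exists m.
  rewrite (_ : 4 / 2 ^+ m = 4 * (1 / 2) ^+ m); first by lra.
  by rewrite expr_div_n expr1n mul1r.
(* Grid values are within 9 / 2^n = 9 / (4 N) of the image, and cells have
   length 1 / N; both together stay below 4 / N < d. *)
pose n := (maxn n0 m + 2)%N.
have nn0 : (n0 <= n)%N by rewrite /n; apply: leq_trans (leq_addr _ _); exact: leq_maxl.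
set N : R := 2 ^+ (n - 2).
have N0 : 0 < N by rewrite exprn_gt0.
have nN : 2 ^+ n = 4 * N :> R.
  rewrite /N /n addnK exprD mulrC; congr (_ * _); ring.
have Nd : 4 / N < d.
  apply: le_lt_trans hm; rewrite ler_pM2l// lef_pV2 ?posrE ?exprn_gt0// /N /n addnK.
  by rewrite ler_weXn2l ?ler1n// leq_maxr.
have [p [p0 ps pF pc]] := discrete_frostman rho rho0 K1 c n K101 K1c.
have [q [q0 qs qF qc]] := discrete_frostman rho rho0 K2 c n K201 K2c.
have [r [r0 rs rF rc]] := discrete_frostman rho rho0 K3 c n K301 K3c.
pose cell (j : nat) : set R := `[j%:R / N - 3, (j%:R + 1) / N - 3[%classic.
pose J := [seq j <- iota 0 (6 * 2 ^ (n - 2)).+1 | `[< cell j `<=` W >]].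
have uJ : uniq J by rewrite filter_uniq// iota_uniq.
have g01 (i : 'I_(2 ^ n)) : 0 <= (gridpt n i : R) <= 1 by exact: gridpt01.
have hJ : e * 2 ^+ (n - 2) <= (size J)%:R.
  apply: (Hn n nn0 p q r) => // a1 a2 a3 i1 i2 i3 /ps[x1 Kx1 xa1] /ps[x2 Kx2 xa2]
    /ps[x3 Kx3 xa3] /qs[y1 Ky1 yi1] /qs[y2 Ky2 yi2] /rs[z1 Kz1 zi3].
  set Phi0 := (X in Num.truncn (_ * (X + 3))).
  have bound : `|Phi0| <= 3.
    apply: (det_form_le3 be ga (gridpt n a1, gridpt n a2, gridpt n a3, (gridpt n i1, gridpt n i2, gridpt n i3))) => //;
    exact: g01.
  have pos : 0 <= 2 ^+ (n - 2) * (Phi0 + 3).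
    by rewrite mulr_ge0 ?exprn_ge0//; move: bound; rewrite ler_norml; lra.
  have := truncn_itv pos; set t := Num.truncn _; rewrite -/N => /andP[t1 t2].
  have tJ : (t < (6 * 2 ^ (n - 2)).+1)%N.
    rewrite ltnS -(ler_nat R) natrM natrX -/N (le_trans t1)//.
    by rewrite mulrC ler_wpM2r ?(ltW N0)//; move: bound; rewrite ler_norml; lra.
  rewrite mem_filter mem_iota /= add0n tJ andbT; apply/asboolP => z.
  rewrite /cell /= in_itv /= => /andP[z1' z2'].
  have zP : `|z - Phi0| <= 1 / N.
    have E1 : t%:R / N <= Phi0 + 3 by rewrite ler_pdivrMr// mulrC.
    have E2 : Phi0 + 3 <= (t%:R + 1) / N.
      by rewrite ler_pdivlMr// [leLHS]mulrC natr1 ltW.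
    have E3 : (t%:R + 1) / N = t%:R / N + 1 / N by rewrite mulrDl.
    rewrite ler_norml; move: E1 E2 E3 z1' z2'; lra.
  pose v := det_form be ga (x1, x2, x3, (y1, y2, z1)).
  have Vv : V v by exists (x1, x2, x3, (y1, y2, z1)).
  have close (K : set R) x i : K `<=` [set x | 0 <= x < 1] -> K x -> dyadic_idx n x = i ->
      `|gridpt n i - x| <= 1 / 2 ^+ n /\ 0 <= x <= 1.
    move=> K01 Kx <-; have /andP[x0 xl] := K01 _ Kx.
    by split; [exact: gridpt_dist_idx|rewrite x0 ltW].
  have [c1 b1] := close _ _ _ K101 Kx1 xa1; have [c2 b2] := close _ _ _ K101 Kx2 xa2.
  have [c3 b3] := close _ _ _ K101 Kx3 xa3; have [c4 b4] := close _ _ _ K201 Ky1 yi1.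
  have [c5 b5] := close _ _ _ K201 Ky2 yi2; have [c6 b6] := close _ _ _ K301 Kz1 zi3.
  have h0 : 0 <= 1 / 2 ^+ n :> R by rewrite divr_ge0 ?exprn_ge0.
  have lip := det_form_lipschitz be ga (1 / 2 ^+ n) _ _ _ _ _ _ _ _ _ _ _ _ be01 ga01' h0
    (g01 a1) (g01 a2) (g01 a3) (g01 i1) (g01 i2) (g01 i3) b1 b2 b3 b4 b5 b6
    c1 c2 c3 c4 c5 c6.
  have lip' : `|Phi0 - v| <= 9 * (1 / 2 ^+ n) by exact: lip.
  apply: (Hd v z Vv); apply: le_lt_trans Nd.
  rewrite (_ : z - v = (z - Phi0) + (Phi0 - v)); last by ring.
  apply: le_trans (ler_normD _ _) _; apply: le_trans (lerD zP lip') _.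
  rewrite nN (_ : 9 * (1 / (4 * N)) = 9 / 4 / N); last by field; rewrite gt_eqF.
  by rewrite -mulrDl ler_pM2r ?invr_gt0//; lra.
have := @cells_measure_le R W N J mO' N0 uJ.
move=> H; have {}H : (((size J)%:R / N)%:E <= lebesgue_measure W)%E.
  by apply: H => j; rewrite mem_filter => /andP[/asboolP + _].
have := le_lt_trans H Oe; rewrite lte_fin ltr_pdivrMr// ltNge.
by move/negP; apply.
Qed.

End assembly.

Lemma exponent_exists {R : realType} (x : \bar R) (a b : R) : a < b -> (a%:E < x)%E ->
  exists2 s : R, a < s < b & (s%:E < x)%E.
Proof.
move=> ab; case: x => [y| |//]; last first.
  by move=> _; exists ((a + b) / 2); [apply/andP; split; lra|exact: ltry].
rewrite lte_fin => ay; pose m := Num.min y b.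
have mb : m <= b by rewrite ge_min lexx orbT.
have my : m <= y by rewrite ge_min lexx.
have am : a < m by rewrite lt_min ay.
by exists ((a + m) / 2); [apply/andP; split; lra|rewrite lte_fin; lra].
Qed.

Lemma det3 (R : comNzRingType) (M : 'M[R]_3) : \det M =
  M 0 0 * (M 1 1 * M 2 2 - M 1 2 * M 2 1) - M 0 1 * (M 1 0 * M 2 2 - M 1 2 * M 2 0)
  + M 0 2 * (M 1 0 * M 2 1 - M 1 1 * M 2 0).
Proof.
rewrite (expand_det_row _ 0) !big_ord_recl big_ord0 /cofactor.
rewrite !(expand_det_row _ 0) !big_ord_recl !big_ord0 /cofactor !det_mx11 !mxE /=.
pose f (i j : nat) := M (inord i) (inord j).
have E i j : M i j = f i j by rewrite /f !inord_val.
rewrite !E /= !addr0 !expr0 ?expr1 /bump /=; ring.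
Qed.

Lemma det_volume {R : realType} (B : 'I_3 -> set R) (be ga : R) (x : R * R * R * (R * R * R)) :
  B 0 x.1.1.1 -> B 0 x.1.1.2 -> B 0 x.1.2 -> B 1 x.2.1.1 -> B 1 x.2.1.2 -> B 2 x.2.2 ->
  B 1 be -> B 2 ga -> volume_set (product_set B) (det_form be ga x).
Proof.
move: x => [[[a1 a2] a3] [[b1 b2] c]] /= A1 A2 A3 B1 B2 C Bbe Bga.
pose col3 (u v w : R) : 'cV[R]_3 := \col_i (if i == 0 then u else if i == 1 then v else w).
pose X (j : 'I_3) := if j == 0 then col3 a1 b1 ga else if j == 1 then col3 a2 b2 ga else col3 a3 be c.
exists X.
  move=> j i; rewrite /X /col3.
  have i3 : [\/ i = 0, i = 1 | i = 2].
    case: i => [[|[|[|//]]] h]; [constructor 1|constructor 2|constructor 3]; exact: val_inj.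
  case: (j == 0); [|case: (j == 1)]; case: i3 => ->; rewrite mxE /=; done.
by rewrite det3 !mxE /X /col3 /= ?mxE /= /det_form /=; ring.
Qed.

Theorem theorem1p5 (R : realType) (B : 'I_3 -> set R)
  (mB : forall j, measurable (B j))
  (B01 : forall j, B j `<=` `[0, 1])
  (dimB : forall j, ((2 / 3)%:E < hausdorff_dim (B j))%E) :
  (0 < completed_lebesgue_measure (volume_set (product_set B)))%E.
Proof.
have ab : 2 / 3 < 1 :> R by lra.
have /choice[t Ht] : forall j, exists s : R, 2 / 3 < s < 1 /\ (s%:E < hausdorff_dim (B j))%E.
  by move=> j; have [s s1 s2] := exponent_exists _ _ _ ab (dimB j); exists s.
pose s := Num.min (t 0) (Num.min (t 1) (t 2)).
have i3 (j : 'I_3) : [\/ j = 0, j = 1 | j = 2].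
  case: j => [[|[|[|//]]] h]; [constructor 1|constructor 2|constructor 3]; exact: val_inj.
have s23 : 2 / 3 < s.
  have lt j : 2 / 3 < t j by have [/andP[]] := Ht j.
  by rewrite !lt_min !lt.
have st j : s <= t j.
  by case: (i3 j) => ->; rewrite !ge_min lexx ?orbT.
have s1 : s < 1 by apply: le_lt_trans (st 0) _; have [/andP[]] := Ht 0.
have s0 : 0 < s by lra.
pose rho := rate s.
have rho0 : 0 < rho := rate_gt0 s.
have rho1 : rho < 1 := rate_lt1 s s0.
have rho2 : 1 / 2 < rho.
  have -> : 1 / 2 = 2 `^ (- 1) :> R by rewrite powRN powRr1// div1r.
  by apply: powR2_lt; rewrite ltrN2.
have rho6 : 16 * rho ^+ 6 < 1.
  have -> : rho ^+ 6 = 2 `^ (- s * 6) by rewrite powRrM powR_mulrn ?powR_ge0.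
  have : 2 `^ (- s * 6) < 2 `^ (- 4%:R) :> R by apply: powR2_lt; lra.
  rewrite powRN powR_mulrn// => h.
  have : 16 * (2 ^+ 4)^-1 = 1 :> R by rewrite -natrX divff.
  lra.
have Kj j : exists cK : R * set R, [/\ 0 < cK.1, cK.2 `<=` B j & thick rho cK.1 cK.2].
  pose A := B j `&` [set x | 0 <= x < 1].
  have c0 : 0 < net_content rho A.
    apply: net_content_gt0 => //; apply: le_lt_trans (Ht j).2.
    by rewrite lee_fin st.
  have A01 : A `<=` [set x | 0 <= x < 1] by move=> x [].
  have mA : measurable A.
    apply: measurableI => //.
    rewrite (_ : [set x | _] = `[0, 1[%classic); first exact: measurable_itv.
    by apply/seteqP; split=> x /=; rewrite in_itv.
  have c2 : net_content rho A / 2 < net_content rho A by lra.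
  have [K [cK KA Kc]] := capacitability rho rho0 A _ A01 (measurable_suslin _ mA) c2.
  exists (net_content rho A / 6, K); split => /=; first by rewrite divr_gt0.
    by move=> x /KA[].
  split=> //; first by move=> x /KA/A01.
  by move=> U b cU cb; have := Kc U b cU cb; lra.
have /choice[cK HcK] := Kj.
pose c := Num.min (cK 0).1 (Num.min (cK 1).1 (cK 2).1).
have c0 : 0 < c.
  have gt j : 0 < (cK j).1 by have [] := HcK j.
  by rewrite !lt_min !gt.
have tK j : thick rho c (cK j).2.
  have [_ _ [k1 k2 k3]] := HcK j; split=> // U b cU cb.
  apply: le_trans (k3 U b cU cb).
  by case: (i3 j) => ->; rewrite !ge_min lexx ?orbT.
have KB j : (cK j).2 `<=` B j by have [] := HcK j.
have [be Kbe _] := thick_pos _ _ rho0 rho1 c0 _ (tK 1).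
have [ga Kga ga0] := thick_pos _ _ rho0 rho1 c0 _ (tK 2).
apply: lt_le_trans (image_measure_gt0 rho c rho2 rho1 rho6 c0 _ _ _ be ga
  (tK 0) (tK 1) (tK 2) Kbe Kga ga0) _.
apply: completed_lebesgue_measure_le => _ [x [[[x1 x2] x3] [[y1 y2] z]] <-].
by apply: det_volume; apply: KB.
Qed.
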